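(* Let $K\subset\mathbb{R}^{2n}$ be a toric convex domain. Then for any smooth path $\phi^t$ in $\mathrm{Symp}$ with $\phi^0=\mathrm{Id}$, $t=0$ is a critical point of the function $t\mapsto \mathrm{M}(\phi^t(K))$. In fact, the derivative $\left.\frac{d}{dt}\right|_{t=0}\mathrm{M}(\phi^t(K))$ exists and is equal to zero.
   Context: For a bounded subset $X\subset\mathbb{R}^{d}$, the support function is $h_X(u)=\sup_{k\in X}\langle k,u\rangle$ and the mean width is $\mathrm{M}(X)=\int_{S^{d-1}}(h_X(u)+h_X(-u))\,d\sigma$, where $\sigma$ is the rotationally invariant probability measure on the unit sphere $S^{d-1}\subset\mathbb{R}^d$. $\mathrm{Symp}$ denotes the group of symplectomorphisms of $\mathbb{R}^{2n}$ with its standard symplectic structure. Identify $\mathbb{R}^{2n}$ (coordinates $(x_1,\dots,x_n,y_1,\dots,y_n)$) with $\mathbb{C}^n$ via $z_j=x_j+iy_j$. A subset of $\mathbb{R}^{2n}=\mathbb{C}^n$ is toric if it is invariant under the action of the $n$-torus $(\theta_1,\dots,\theta_n)\cdot(z_1,\dots,z_n)=(e^{i\theta_1}z_1,\dots,e^{i\theta_n}z_n)$. A toric convex domain is a convex body (compact convex set with nonempty interior) that is toric. A path $\phi^t$ in $\mathrm{Symp}$, defined for $t$ in an open interval around $0$, is smooth if $(t,z)\mapsto\phi^t(z)$ is smooth. *)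

(* Defs.v *)
From HB Require Import structures.
From mathcomp Require Import all_boot all_order all_algebra.
From mathcomp Require Import all_classical all_reals all_analysis.

Set Implicit Arguments.
Unset Strict Implicit.
Unset Printing Implicit Defensive.

Import Order.TTheory GRing.Theory Num.Theory.
Import numFieldNormedType.Exports.

Local Open Scope classical_set_scope.
Local Open Scope ring_scope.

(* For an open set U: f is of class C^k (resp. C^oo) on U. *)
Fixpoint Ck_on (R : realType) (V W : normedModType R) (k : nat)
    (U : set V) (f : V -> W) : Prop :=
  match k with
  | 0 => forall x, U x -> {for x, continuous f}
  | k'.+1 => (forall x, U x -> differentiable f x) /\
             (forall v : V, Ck_on k' U ('D_v f))
  end.

Definition smooth_on (R : realType) (V W : normedModType R)
    (U : set V) (f : V -> W) : Prop :=
  forall k : nat, Ck_on k U f.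

Section MeanWidth.
Context {R : realType} {d : nat}.

(* The library norm on row vectors is the sup norm, hence an explicit
   Euclidean inner product. *)
Definition dot (u v : 'rV[R]_d) : R := \sum_(i < d) u 0 i * v 0 i.

Definition unit_sphere : set 'rV[R]_d := [set u | dot u u = 1].

Definition support_function (X : set 'rV[R]_d) (u : 'rV[R]_d) : R :=
  sup [set dot k u | k in X].

Definition borel_rV := g_sigma_algebraType (@open 'rV[R]_d).

Definition rotation (Q : 'M[R]_d) : Prop := Q *m Q^T = 1%:M /\ \det Q = 1.

(* sigma is a rotationally invariant probability measure on the unit sphere,
   seen as a Borel probability measure on R^d carried by the sphere.  For
   d >= 2 the rotations act transitively on the sphere and these properties
   determine sigma. *)
Definition rotation_invariant_on_sphere (sigma : probability borel_rV R) : Prop :=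
  sigma unit_sphere = 1%E /\
  forall Q : 'M[R]_d, rotation Q -> forall A : set borel_rV, measurable A ->
    sigma ((fun u : 'rV[R]_d => u *m Q) @` A) = sigma A.

Definition mean_width (sigma : probability borel_rV R) (X : set 'rV[R]_d) : R :=
  Rintegral sigma unit_sphere
    (fun u : 'rV[R]_d => support_function X u + support_function X (- u)).

Definition convex_body (K : set 'rV[R]_d) : Prop :=
  [/\ compact K, convex_set K & K° !=set0].

End MeanWidth.

(* Points of R^(2n) are row vectors (x_1, ..., x_n, y_1, ..., y_n): coordinate
   lshift n j is x_j and coordinate rshift n j is y_j. *)
Section Symplectic.
Context {R : realType} {n : nat}.

Definition symplectic_form (v w : 'rV[R]_(n + n)) : R :=
  \sum_(j < n) (v 0 (lshift n j) * w 0 (rshift n j)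
                - v 0 (rshift n j) * w 0 (lshift n j)).

Definition symplectomorphism (f : 'rV[R]_(n + n) -> 'rV[R]_(n + n)) : Prop :=
  [/\ smooth_on setT f,
      exists g : 'rV[R]_(n + n) -> 'rV[R]_(n + n),
        [/\ cancel f g, cancel g f & smooth_on setT g]
    & forall z v w : 'rV[R]_(n + n),
        symplectic_form ('d f z v) ('d f z w) = symplectic_form v w].

(* z_j |-> e^(i theta_j) z_j with z_j = x_j + i y_j, in real coordinates. *)
Definition torus_act (theta : 'I_n -> R) (z : 'rV[R]_(n + n)) : 'rV[R]_(n + n) :=
  row_mx
    (\row_(j < n) (cos (theta j) * z 0 (lshift n j)
                   - sin (theta j) * z 0 (rshift n j)))
    (\row_(j < n) (sin (theta j) * z 0 (lshift n j)
                   + cos (theta j) * z 0 (rshift n j))).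

Definition toric (K : set 'rV[R]_(n + n)) : Prop :=
  forall theta : 'I_n -> R, torus_act theta @` K = K.

Definition toric_convex_domain (K : set 'rV[R]_(n + n)) : Prop :=
  convex_body K /\ toric K.

(* Values of phi outside the open interval I are irrelevant. *)
Definition smooth_symp_path (I : set R)
    (phi : R -> 'rV[R]_(n + n) -> 'rV[R]_(n + n)) : Prop :=
  (forall t, I t -> symplectomorphism (phi t)) /\
  smooth_on (I `*` setT)
    (fun p : R * 'rV[R]_(n + n) => phi p.1 p.2).

End Symplectic.

(* Main.v *)
Require Import Defs.
From HB Require Import structures.
From mathcomp Require Import all_boot all_order all_algebra.
From mathcomp Require Import all_classical all_reals all_analysis.
From mathcomp Require Import measurable_realfun.
From mathcomp Require Import ring lra.

(** Let X be the velocity of the path at time 0, let h be the support function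
    of K and let k(u) be the point of K at which <., u> is maximal. The mean
    width is an integral of support functions over the sphere, and the support
    function of phi^t(K) at u has derivative <X(k(u)), u> at time 0 as soon as
    k(u) is unique ([support_derivative]). So the derivative of the mean width
    is twice the integral of <X(k(u)), u>, and three facts have to be proved.

    Uniqueness. For almost every u the maximizer is unique ([ae_exposed]). If
    it is not, h has a corner at u in the direction of some coordinate
    rotation. The second difference of h along that rotation detects the
    corner, but its integral vanishes because the measure is invariant.

    Vanishing. Split X into its components X_j in the n symplectic coordinate
    planes. Since K is toric, k(u) and u are parallel in each of these planes
    ([maximizer_parallel]) and k commutes with the torus. Hence the average of
    <X_j(k(u)), u> over the j-th circle of the torus is a multiple of the flux
    of X_j through a circle in the j-th plane. This flux is zero, because the
    velocity of a path of symplectomorphisms has no divergence in any of these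
    planes ([velocity_divergence_free], [circle_average]). The measure is
    invariant under the torus, so that the integral of <X(k(u)), u> is zero.

    Passage to the limit. The averages are taken over finitely many rotations
    and inside the difference quotients, before time tends to 0. In this way
    dominated convergence applies to continuous functions of u only
    ([Rintegral_support_quotient_small]). *)

Set Implicit Arguments.
Unset Strict Implicit.
Unset Printing Implicit Defensive.

Import Order.TTheory GRing.Theory Num.Theory.
Import numFieldNormedType.Exports.

Local Open Scope classical_set_scope.
Local Open Scope ring_scope.

(** * Euclidean product and plane rotations *)

Section Dot.
Context {R : realType} {d : nat}.
Implicit Types u v w : 'rV[R]_d.

Lemma dotE u v : dot u v = (u *m v^T) 0 0.
Proof. by rewrite mxE; apply: eq_bigr => i _; rewrite mxE. Qed.

Lemma dotC u v : dot u v = dot v u.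
Proof. by apply: eq_bigr => i _; rewrite mulrC. Qed.

Lemma dotDl u v w : dot (u + v) w = dot u w + dot v w.
Proof. by rewrite !dotE mulmxDl mxE. Qed.

Lemma dotZl a u w : dot (a *: u) w = a * dot u w.
Proof. by rewrite !dotE -scalemxAl mxE. Qed.

Lemma dotNl u w : dot (- u) w = - dot u w.
Proof. by rewrite -scaleN1r dotZl mulN1r. Qed.

Lemma dotBl u v w : dot (u - v) w = dot u w - dot v w.
Proof. by rewrite dotDl dotNl. Qed.

Lemma dot0l w : dot 0 w = 0.
Proof. by rewrite dotE mul0mx mxE. Qed.

Lemma dotDr u v w : dot w (u + v) = dot w u + dot w v.
Proof. by rewrite dotC dotDl !(dotC _ w). Qed.

Lemma dotZr a u w : dot w (a *: u) = a * dot w u.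
Proof. by rewrite dotC dotZl (dotC w). Qed.

Lemma dotBr u v w : dot w (u - v) = dot w u - dot w v.
Proof. by rewrite dotC dotBl !(dotC _ w). Qed.

Lemma dotNr u w : dot w (- u) = - dot w u.
Proof. by rewrite dotC dotNl dotC. Qed.

Lemma dot_mulmxl u v (Q : 'M[R]_d) : dot (u *m Q) v = dot u (v *m Q^T).
Proof. by rewrite !dotE trmx_mul trmxK mulmxA. Qed.

Lemma dot_orthogonal (Q : 'M[R]_d) u v : Q *m Q^T = 1%:M ->
  dot (u *m Q) (v *m Q) = dot u v.
Proof. by move=> QQ; rewrite dot_mulmxl -mulmxA QQ mulmx1. Qed.

Lemma ler_coord_norm u i : `|u 0 i| <= `|u|.
Proof.
rewrite [leRHS]/Num.Def.normr/= mx_normrE.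
exact: (le_bigmax _ (fun p => `|u p.1 p.2|) (0, i)).
Qed.

(** The norm on row vectors is the maximum norm, which costs a factor [d]. *)
Lemma ler_norm_dot u v : `|dot u v| <= d%:R * `|u| * `|v|.
Proof.
rewrite (le_trans (ler_norm_sum _ _ _))//.
rewrite (@le_trans _ _ (\sum_(i < d) `|u| * `|v|))//.
  by apply: ler_sum => i _; rewrite normrM ler_pM// ler_coord_norm.
by rewrite sumr_const card_ord -[leLHS]mulr_natl mulrA.
Qed.

Lemma sphere_norm u : unit_sphere u -> `|u| <= 1.
Proof.
move=> u1; rewrite [leLHS]/Num.Def.normr/= mx_normrE.
apply: bigmax_le => // -[i j] _ /=.
rewrite ord1 -(@ler_pXn2r _ 2)// ?nnegrE// expr1n -normrX ger0_norm ?sqr_ge0//.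
rewrite -[leRHS]u1 /dot (bigD1 j)//= expr2 lerDl.
by apply: sumr_ge0 => k _; rewrite -expr2 sqr_ge0.
Qed.

Lemma norm_sphere_dot u v : unit_sphere u -> `|dot v u| <= d%:R * `|v|.
Proof.
move=> u1; apply: (le_trans (ler_norm_dot _ _)).
by rewrite -[leRHS]mulr1 ler_wpM2l ?sphere_norm// mulr_ge0.
Qed.

End Dot.

Section PlaneRotation.
Context {R : realType} {d : nat}.
Variables (i j : 'I_d).

Definition plane_proj : 'M[R]_d := delta_mx i i + delta_mx j j.
Definition plane_gen : 'M[R]_d := delta_mx i j - delta_mx j i.
(** The exponential of [s *: plane_gen], which acts on row vectors from the
    right. *)
Definition plane_rot (s : R) : 'M[R]_d :=
  1%:M + (cos s - 1) *: plane_proj + sin s *: plane_gen.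

Lemma trmx_plane_proj : plane_proj^T = plane_proj.
Proof. by rewrite linearD /= !trmx_delta. Qed.

Lemma trmx_plane_gen : plane_gen^T = - plane_gen.
Proof. by rewrite linearB /= !trmx_delta opprB. Qed.

Lemma trmx_plane_rot s : (plane_rot s)^T = plane_rot (- s).
Proof.
rewrite /plane_rot 2!linearD/= !linearZ/= trmx1 trmx_plane_proj trmx_plane_gen.
by rewrite cosN sinN scalerN scaleNr.
Qed.

Lemma plane_rot0 : plane_rot 0 = 1%:M.
Proof. by rewrite /plane_rot cos0 sin0 subrr !scale0r !addr0. Qed.

Hypothesis ij : i != j.

Lemma plane_projK : plane_proj *m plane_proj = plane_proj.
Proof.
rewrite /plane_proj mulmxDl !mulmxDr !mul_delta_mx_cond !eqxx.
by rewrite (negbTE ij) (eq_sym j) (negbTE ij) !mulr0n !mulr1n addr0 add0r.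
Qed.

Lemma plane_proj_gen : plane_proj *m plane_gen = plane_gen.
Proof.
rewrite /plane_proj /plane_gen mulmxDl !mulmxBr !mul_delta_mx_cond !eqxx.
by rewrite (negbTE ij) (eq_sym j) (negbTE ij) !mulr0n !mulr1n subr0 sub0r.
Qed.

Lemma plane_gen_proj : plane_gen *m plane_proj = plane_gen.
Proof.
rewrite /plane_proj /plane_gen mulmxBl !mulmxDr !mul_delta_mx_cond !eqxx.
by rewrite (negbTE ij) (eq_sym j) (negbTE ij) !mulr0n !mulr1n add0r addr0.
Qed.

Lemma plane_genK : plane_gen *m plane_gen = - plane_proj.
Proof.
rewrite /plane_proj /plane_gen mulmxBl !mulmxBr !mul_delta_mx_cond !eqxx.
rewrite (negbTE ij) (eq_sym j) (negbTE ij) !mulr0n !mulr1n sub0r subr0.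
by rewrite opprD.
Qed.

Lemma plane_rotD s t : plane_rot s *m plane_rot t = plane_rot (s + t).
Proof.
rewrite /plane_rot cosD sinD.
rewrite !(mulmxDl, mulmxDr, mul1mx, mulmx1).
rewrite -!(scalemxAl, scalemxAr) plane_projK plane_proj_gen plane_gen_proj.
rewrite plane_genK !scalerA.
by apply/matrixP => a b; rewrite !mxE; ring.
Qed.

Lemma plane_rot_orthogonal s : plane_rot s *m (plane_rot s)^T = 1%:M.
Proof. by rewrite trmx_plane_rot plane_rotD subrr plane_rot0. Qed.

(** The determinant is 1 because a plane rotation is the square of the rotation
    by half its angle, and an orthogonal matrix has determinant 1 or -1. *)
Lemma plane_rotP s : rotation (plane_rot s).
Proof.
split; first exact: plane_rot_orthogonal.
have -> : s = s / 2 + s / 2 by field.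
rewrite -plane_rotD det_mulmx -[X in _ * X]det_tr -det_mulmx.
by rewrite plane_rot_orthogonal det1.
Qed.

End PlaneRotation.

(** * Support functions and their first variation *)

Lemma bounded_slope_continuous (R : realType) (V W : normedModType R)
    (f : V -> W) c :
  (forall u v, `|f u - f v| <= c * `|u - v|) -> continuous f.
Proof.
move=> fc u; apply/cvgrPdist_le => e e0.
have c0 : 0 < `|c| + 1 by rewrite ltr_wpDl.
have : \forall v \near u, `|u - v| <= e / (`|c| + 1).
  by apply: cvgr_dist_le; [exact: cvg_id|rewrite divr_gt0].
apply: filterS => v uv; apply: (le_trans (fc _ _)).
rewrite (@le_trans _ _ ((`|c| + 1) * `|u - v|))//.
  by rewrite ler_wpM2r// ler_wpDr// ler_norm.
by rewrite mulrC -ler_pdivlMr.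
Qed.

Section DotContinuity.
Context {R : realType} {d : nat}.

Lemma dot_continuous (T : topologicalType) (f g : T -> 'rV[R]_d) x :
  {for x, continuous f} -> {for x, continuous g} ->
  {for x, continuous (fun y => dot (f y) (g y))}.
Proof.
move=> fx gx.
apply: cvg_big => [|i _]; first exact: add_continuous.
apply: cvgM.
- apply: (@continuous_comp _ _ _ f (fun v : 'rV[R]_d => v 0 i)) => //.
  exact: coord_continuous.
- apply: (@continuous_comp _ _ _ g (fun v : 'rV[R]_d => v 0 i)) => //.
  exact: coord_continuous.
Qed.

End DotContinuity.

Section SupportFunction.
Context {R : realType} {d : nat}.
Implicit Types (K : set 'rV[R]_d) (u v k : 'rV[R]_d).

Lemma support_ub K c u k : (forall z, K z -> dot z u <= c) -> K k ->
  dot k u <= support_function K u.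
Proof.
move=> Kc Kk; apply: sup_upper_bound; last by exists k.
by split; [exists (dot k u), k|exists c => _ [z Kz <-]; exact: Kc].
Qed.

Lemma support_ge K M u k : (forall z, K z -> `|z| <= M) -> K k ->
  dot k u <= support_function K u.
Proof.
move=> KM; apply: (@support_ub _ (d%:R * M * `|u|)) => z Kz.
apply: (le_trans (ler_norm _)); apply: (le_trans (ler_norm_dot _ _)).
by rewrite ler_wpM2r// ler_wpM2l// KM.
Qed.

Lemma support_le K u c : K !=set0 -> (forall k, K k -> dot k u <= c) ->
  support_function K u <= c.
Proof.
move=> [k Kk] Kc; apply: ge_sup; first by exists (dot k u), k.
by move=> _ [z Kz <-]; exact: Kc.
Qed.

Lemma support_max K M u k : (forall z, K z -> `|z| <= M) -> K k ->
  (forall z, K z -> dot z u <= dot k u) -> support_function K u = dot k u.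
Proof.
move=> KM Kk kmax; apply/eqP; rewrite eq_le (support_ge u KM Kk) andbT.
by apply: support_le => //; exists k.
Qed.

Lemma support_lipschitz K M u v : K !=set0 -> (forall z, K z -> `|z| <= M) ->
  `|support_function K u - support_function K v| <= d%:R * M * `|u - v|.
Proof.
move=> K0 KM.
have H a b : support_function K a - support_function K b <= d%:R * M * `|a - b|.
  rewrite lerBlDl; apply: support_le => // k Kk.
  rewrite -(subrK b a) dotDr addrC subrK lerD//; first exact: support_ge KM Kk.
  apply: (le_trans (ler_norm _)); apply: (le_trans (ler_norm_dot _ _)).
  by rewrite ler_wpM2r// ler_wpM2l// KM.
by rewrite ler_norml H lerNl opprB distrC H.
Qed.

Lemma support_continuous K M : K !=set0 -> (forall z, K z -> `|z| <= M) ->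
  continuous (support_function K).
Proof.
move=> K0 KM.
by apply: (@bounded_slope_continuous _ _ _ _ (d%:R * M)) => u v;
  exact: support_lipschitz.
Qed.

(** The supremum over [K] of linear forms moves at most by the largest change of
    one of them. *)
Lemma support_perturb K M (f : 'rV[R]_d -> 'rV[R]_d) c u : K !=set0 ->
  (forall z, K z -> `|z| <= M) -> (forall z, K z -> `|f z - z| <= c) ->
  `|support_function (f @` K) u - support_function K u| <= d%:R * c * `|u|.
Proof.
move=> K0 KM fc.
have fKM z : (f @` K) z -> `|z| <= M + c.
  move=> [k Kk <-]; rewrite -(subrK k (f k)) addrC (le_trans (ler_normD _ _))//.
  by rewrite lerD ?KM ?fc.
have fK0 : (f @` K) !=set0 by case: K0 => k Kk; exists (f k), k.
have err k : K k -> `|dot (f k) u - dot k u| <= d%:R * c * `|u|.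
  move=> Kk; rewrite -dotBl; apply: (le_trans (ler_norm_dot _ _)).
  by rewrite ler_wpM2r// ler_wpM2l// fc.
rewrite ler_norml lerNl opprB !lerBlDr; apply/andP; split.
- apply: support_le => // k Kk.
  have := err k Kk; rewrite distrC => /(le_trans (ler_norm _)).
  rewrite lerBlDr => /le_trans; apply; rewrite lerD2l.
  by apply: support_ge fKM _; exists k.
- apply: support_le => // _ [k Kk <-].
  have := le_trans (ler_norm _) (err k Kk).
  rewrite lerBlDr => /le_trans; apply; rewrite lerD2l.
  exact: support_ge KM _.
Qed.

(** The exposed points of [K] with outer normal [u]; when [K] is a convex body,
    such a [k] is the gradient at [u] of the support function of [K]. *)
Definition exposed K u k :=
  K k /\ forall z, K z -> z != k -> dot z u < dot k u.

Lemma exposed_le K u k z : exposed K u k -> K z -> dot z u <= dot k u.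
Proof.
move=> [Kk kmax] Kz; have [->//|zk] := eqVneq z k.
by rewrite ltW// kmax.
Qed.

Lemma exposed_mulmx K (Q : 'M[R]_d) u k : Q *m Q^T = 1%:M ->
  [set z *m Q | z in K] = K -> exposed K u k -> exposed K (u *m Q) (k *m Q).
Proof.
move=> QQ QK [Kk kmax]; split; first by rewrite -QK; exists k.
move=> z; rewrite -{1}QK => -[{}z Kz <-] zk; rewrite !dot_orthogonal//.
by apply: kmax => //; apply: contra_neq zk => ->.
Qed.

(** A support function sees a deformation only through the velocity field [X]
    at time 0, and it sees all of [K] at once, so that the remainder has to be
    small uniformly on [K]. *)
Definition first_order K (psi : R -> 'rV[R]_d -> 'rV[R]_d)
    (X : 'rV[R]_d -> 'rV[R]_d) :=
  forall e, 0 < e -> \forall t \near 0,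
    forall k, K k -> `|psi t k - k - t *: X k| <= e * `|t|.

Lemma first_order_bound K psi X B : first_order K psi X ->
  (forall k, K k -> `|X k| <= B) ->
  \forall t \near 0, forall k, K k -> `|psi t k - k| <= (B + 1) * `|t|.
Proof.
move=> psiX XB; have := psiX 1 ltr01; apply: filterS => t tX k Kk.
rewrite -(subrK (t *: X k) (psi t k - k)) (le_trans (ler_normD _ _))//.
by rewrite addrC mulrDl lerD ?tX// normrZ mulrC ler_wpM2r ?XB.
Qed.

(** Danskin's envelope theorem: at first order the supremum over [K] follows its
    unique maximizer. Near [k] the velocity term is almost that of [k], while a
    point away from [k] loses a fixed amount, which small times cannot make up
    for; compactness of [K] makes this uniform. *)
Lemma support_derivative K M psi (X : 'rV[R]_d -> 'rV[R]_d) u k : compact K ->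
    (forall z, K z -> `|z| <= M) -> continuous X ->
    first_order K psi X -> exposed K u k ->
  forall e : R, 0 < e -> \forall t \near 0,
    `|support_function (psi t @` K) u - support_function K u
      - t * dot (X k) u| <= e * `|t|.
Proof.
move=> cK KM cX psiX ku e e0; have [Kk kmax] := ku.
have hk : support_function K u = dot k u.
  by apply: support_max KM _ _ => // z Kz; exact: exposed_le ku Kz.
have c0 : 0 < d%:R * `|u| + 1 by rewrite ltr_wpDl// mulr_ge0.
set c := d%:R * `|u| + 1 in c0.
have e20 : 0 < e / 2 by rewrite divr_gt0.
have cdot : continuous (fun z => dot (X z) u).
  by move=> z; apply: dot_continuous; [exact: cX|exact: cst_continuous].
have near_max : \forall t \near (0 : R), K `<=` (fun z =>
    dot z u + t * dot (X z) u <= dot k u + t * dot (X k) u + e / 2 * `|t|).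
  have /near_covering_withinP cover := (compact_near_coveringP K).1 cK.
  apply: (cover R (nbhs 0)) => x Kx.
  have [->|xk] := eqVneq x k.
  - have : \forall z \near k, `|dot (X k) u - dot (X z) u| <= e / 2.
      by move/cvgrPdist_le : (cdot k); apply.
    move=> Hk; near=> z t => Kz /=.
    rewrite -addrA lerD ?(exposed_le ku)// -lerBlDl -mulrBr.
    apply: (le_trans (ler_norm _)); rewrite normrM mulrC ler_wpM2r//.
    rewrite distrC; near: z; exact: Hk.
  - have lt : dot x u - dot k u < 0 by rewrite subr_lt0 kmax.
    have cont : {for (x, 0 : R), continuous (fun p : 'rV[R]_d * R =>
        dot p.1 u - dot k u + p.2 * (dot (X p.1) u - dot (X k) u))}.
      apply: cvgD.
        apply: cvgB; last exact: cvg_cst.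
        by apply: dot_continuous; [exact: cvg_fst|exact: cst_continuous].
      apply: cvgM; first exact: cvg_snd.
      apply: cvgB; last exact: cvg_cst.
      apply: dot_continuous; last exact: cst_continuous.
      by apply: (@continuous_comp _ _ _ fst X); [exact: cvg_fst|exact: cX].
    have : \forall p \near (x, 0 : R),
        dot p.1 u - dot k u + p.2 * (dot (X p.1) u - dot (X k) u) < 0.
      apply: (cvgr_lt _ cont) => /=.
      by rewrite mul0r addr0.
    apply: filterS => -[z t] /= H Kz.
    have : 0 <= e / 2 * `|t| by rewrite mulr_ge0// ltW.
    lra.
have := psiX (e / 2 / c); rewrite divr_gt0// => /(_ isT) expand.
near=> t.
have errt z : K z ->
    `|dot (psi t z) u - dot z u - t * dot (X z) u| <= e / 2 * `|t|.
  move=> Kz; rewrite -dotZl -!dotBl (le_trans (ler_norm_dot _ _))//.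
  have : `|psi t z - z - t *: X z| <= e / 2 / c * `|t|.
    by apply: (near expand t) => //.
  move=> H; rewrite mulrAC.
  apply: (@le_trans _ _ (c * (e / 2 / c * `|t|))).
    by rewrite ler_pM ?mulr_ge0// /c lerDl.
  by rewrite mulrA (mulrC c) divfK ?gt_eqF.
have tmax : forall z, K z -> dot z u + t * dot (X z) u <=
    dot k u + t * dot (X k) u + e / 2 * `|t|.
  by move=> z; apply: (near near_max t).
have ubt z : (psi t @` K) z -> dot z u <= dot k u + t * dot (X k) u + e * `|t|.
  move=> [x Kx <-]; have := tmax x Kx.
  have := le_trans (ler_norm _) (errt x Kx); lra.
rewrite hk ler_norml; apply/andP; split.
- have : dot (psi t k) u <= support_function (psi t @` K) u.
    by apply: support_ub ubt _; exists k.
  have := errt k Kk; rewrite ler_norml => /andP[+ _].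
  have : 0 <= e / 2 * `|t| by rewrite mulr_ge0// ltW.
  lra.
- have : support_function (psi t @` K) u <= dot k u + t * dot (X k) u + e * `|t|.
    by apply: support_le => //; exists (psi t k), k.
  lra.
Unshelve. all: by end_near. Qed.

End SupportFunction.

(** * Integration on the sphere *)

Section RealContinuity.
Context {R : realType} {T : topologicalType}.
Implicit Types (f g : T -> R) (c : R).

Lemma continuous_normr f : continuous f -> continuous (fun u => `|f u|).
Proof. by move=> cf u; apply: cvg_norm; exact: cf. Qed.

Lemma continuous_addr f c : continuous f -> continuous (fun u => f u + c).
Proof. by move=> cf u; apply: cvgD; [exact: cf|exact: cvg_cst]. Qed.

Lemma continuous_add f g : continuous f -> continuous g ->
  continuous (fun u => f u + g u).
Proof. by move=> cf cg u; apply: cvgD; [exact: cf|exact: cg]. Qed.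

Lemma continuous_sub f g : continuous f -> continuous g ->
  continuous (fun u => f u - g u).
Proof. by move=> cf cg u; apply: cvgB; [exact: cf|exact: cg]. Qed.

Lemma continuous_mulr f c : continuous f -> continuous (fun u => f u * c).
Proof. by move=> cf u; apply: cvgM; [exact: cf|exact: cvg_cst]. Qed.

Lemma continuous_mull f c : continuous f -> continuous (fun u => c * f u).
Proof. by move=> cf u; apply: cvgM; [exact: cvg_cst|exact: cf]. Qed.

Lemma continuous_excess f c : continuous f ->
  continuous (fun u => Num.max (`|f u| - c) 0).
Proof.
move=> /continuous_normr/(@continuous_addr _ (- c)) cf u.
apply: (@continuous_max _ _ (fun v => `|f v| - c) (cst 0)); first exact: cf.
exact: cst_continuous.
Qed.

End RealContinuity.

Section SphereIntegral.
Context {R : realType} {d : nat}.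
Local Notation V := 'rV[R]_d.
Local Notation S := (@unit_sphere R d).

Lemma measurable_closed (A : set V) :
  closed A -> measurable (A : set (@borel_rV R d)).
Proof.
move=> cA; rewrite -(setCK A); apply: measurableC.
by apply: sub_sigma_algebra; exact: closed_openC.
Qed.

Lemma continuous_borel_measurable (g : V -> R) : continuous g ->
  measurable_fun setT (g : @borel_rV R d -> R).
Proof.
move=> /continuousP cg; apply: (measurability _ (RGenOpens.measurableE R)).
move=> _ [_ [a [b ->] <-]]; rewrite setTI; apply: sub_sigma_algebra.
exact/cg/interval_open.
Qed.

Lemma ler_norm_mulmx (u : V) (Q : 'M[R]_d) : `|u *m Q| <= d%:R * `|Q| * `|u|.
Proof.
rewrite [leLHS]/Num.Def.normr/= mx_normrE; apply: bigmax_le => [|[i j] _ /=].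
  by rewrite !mulr_ge0.
rewrite mxE (le_trans (ler_norm_sum _ _ _))//.
rewrite (@le_trans _ _ (\sum_(i < d) `|Q| * `|u|))//.
  apply: ler_sum => k _; rewrite normrM mulrC ord1 ler_pM ?ler_coord_norm//.
  by rewrite [leRHS]/Num.Def.normr/= mx_normrE
    (le_bigmax _ (fun p => `|Q p.1 p.2|) (k, j)).
by rewrite sumr_const card_ord -[leLHS]mulr_natl mulrA.
Qed.

Lemma mulmx_continuous (Q : 'M[R]_d) : continuous (fun u : V => u *m Q).
Proof.
apply: (@bounded_slope_continuous _ V V (fun u => u *m Q) (d%:R * `|Q|)) => u v.
by rewrite -mulmxBl ler_norm_mulmx.
Qed.

Lemma mulmx_borel_measurable (Q : 'M[R]_d) :
  measurable_fun setT ((fun u : V => u *m Q) : @borel_rV R d -> @borel_rV R d).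
Proof.
have /continuousP cQ := @mulmx_continuous Q.
apply: (@measurability _ _ (@borel_rV R d) (@borel_rV R d) _ _ (@open V)) => //.
move=> _ [A oA <-]; rewrite setTI.
by apply: sub_sigma_algebra; exact: cQ.
Qed.

Lemma sphere_closed : closed S.
Proof.
rewrite (_ : S = (fun u => dot u u) @^-1` [set 1])//.
apply: preimage_closed; last exact: closed_eq.
by move=> u _; apply: dot_continuous; exact: cvg_id.
Qed.

Lemma sphere_compact : compact S.
Proof.
apply: bounded_closed_compact; last exact: sphere_closed.
exists 1; split => // r r1 u /sphere_norm u1; exact: le_trans u1 (ltW r1).
Qed.

Lemma sphere_measurable : measurable (S : set (@borel_rV R d)).
Proof. by apply: measurable_closed; exact: sphere_closed. Qed.

Variable sigma : probability (@borel_rV R d) R.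

Lemma continuous_integrable (g : V -> R) : continuous g ->
  sigma.-integrable S (EFin \o g).
Proof.
move=> cg; apply: measurable_bounded_integrable.
- exact: sphere_measurable.
- by rewrite (le_lt_trans (probability_le1 _ sphere_measurable))// ltry.
- by apply: measurable_funTS; exact: continuous_borel_measurable.
- have : compact (g @` S).
    by apply: continuous_compact sphere_compact; exact: continuous_subspaceT.
  move=> /compact_bounded[M [Mr bM]]; exists M; split => // r Mr' u Su.
  by apply: bM => //; exists u.
Qed.

Hypothesis hsigma : rotation_invariant_on_sphere sigma.

(** Invariance of the measure says that pushing it forward by [Q] does not
    change it: the preimage of a set under [Q] is its image under [Q^T]. *)
Lemma Rintegral_rotation (Q : 'M[R]_d) (g : V -> R) : rotation Q ->
  continuous g ->
  \int[sigma]_(u in S) g (u *m Q) = \int[sigma]_(u in S) g u.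
Proof.
move=> [QQ detQ] cg; congr fine.
have QQ' : Q^T *m Q = 1%:M by exact: mulmx1C.
have rQ' : rotation Q^T by split; rewrite ?trmxK ?det_tr.
have SQ : (fun u => u *m Q) @^-1` S = S.
  by apply/seteqP; split => u; rewrite /unit_sphere /= dot_orthogonal.
have mQ := mulmx_borel_measurable Q.
rewrite -[in LHS]SQ.
rewrite -(integral_pushforward mQ (f := EFin \o g)) ?SQ//; last 3 first.
- apply/measurable_EFinP; exact: continuous_borel_measurable.
- apply: (continuous_integrable (g := fun u => g (u *m Q))) => u.
  apply: (@continuous_comp _ _ _ (fun u : V => u *m Q) g); last exact: cg.
  exact: mulmx_continuous.
- exact: sphere_measurable.
apply: eq_measure_integral => A mA AS.
rewrite /pushforward -[RHS](hsigma.2 _ rQ')//; congr (sigma _).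
apply/seteqP; split => u /=.
  by exists (u *m Q) => //; rewrite -mulmxA QQ mulmx1.
by move=> [v Av <-]; rewrite -mulmxA QQ' mulmx1.
Qed.

Lemma Rintegral_sphere_cst (c : R) : \int[sigma]_(u in S) c = c.
Proof.
rewrite Rintegral_cst; last exact: sphere_measurable.
rewrite -[RHS]mulr1 -[in RHS]/(fine 1%E); congr (_ * fine _).
exact: hsigma.1.
Qed.

(** By Markov's inequality the set where every [f m] is at least [1 / p] has
    measure at most [p] times the integral of any [f m]. *)
Lemma ae_small_of_Rintegral (f : nat -> V -> R) :
  (forall m, continuous (f m)) -> (forall m u, S u -> 0 <= f m u) ->
  (fun m => \int[sigma]_(u in S) f m u) @ \oo --> 0 ->
  {ae sigma, forall u, S u -> forall e, 0 < e -> exists m, f m u < e}.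
Proof.
move=> cf f0 If.
pose A p := [set u | S u /\ forall m, p.+1%:R^-1 <= f m u].
have mA p : measurable (A p : set (@borel_rV R d)).
  apply: measurable_closed.
  have -> : A p = S `&` \bigcap_m (f m @^-1` [set x | p.+1%:R^-1 <= x]).
    by apply/seteqP; split => u [Su Au]; split => // m; have := Au m; [|apply].
  apply: closedI; first exact: sphere_closed.
  apply: closed_bigI => m _; apply: preimage_closed; last exact: closed_ge.
  by move=> u _; exact: cf.
have A0 p : sigma (A p) = 0%E.
  have a0 : 0 < p.+1%:R^-1 :> R by rewrite invr_gt0.
  have sAfin : sigma (A p) \is a fin_num by exact: fin_num_measure.
  have bound m : p.+1%:R^-1 * fine (sigma (A p)) <= \int[sigma]_(u in S) f m u.
    have mf : @measurable_fun _ _ (@borel_rV R d) (\bar R) S (EFin \o f m).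
      apply/measurable_EFinP; apply: measurable_funTS.
      exact: continuous_borel_measurable.
    have := @le_integral_comp_abse _ _ _ sigma _ sphere_measurable _ _ id
      (@measurable_id _ _ _) (fun r r0 => r0) (fun x y _ _ => id) mf a0.
    move=> H; rewrite -lee_fin EFinM fineK// fineK; last first.
      exact: (integrable_fin_num sphere_measurable (continuous_integrable (cf m))).
    apply: le_trans; last first.
      apply: (le_trans H); apply: ge0_le_integral => //.
      - exact: sphere_measurable.
      - by apply: measurableT_comp.
      - by move=> u Su /=; rewrite ger0_norm// f0.
    rewrite lee_pmul2l//.
    apply: le_measure; rewrite ?inE//.
      apply: emeasurable_fun_c_infty; first exact: sphere_measurable.
      exact: measurableT_comp.
    move=> u [Su Au]; split => //=; rewrite lee_fin.
    exact: le_trans (Au m) (ler_norm _).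
  have : p.+1%:R^-1 * fine (sigma (A p)) <= 0.
    rewrite -(cvg_lim _ If)//; apply: limr_ge; [by apply: cvgP If|exact: nearW].
  rewrite pmulr_rle0// => sA.
  by apply/eqP; rewrite eq_le measure_ge0 -(fineK sAfin) lee_fin sA.
have nA : sigma.-negligible (\bigcup_p A p).
  by apply: negligible_bigcup => p; exists (A p); split; [exact: mA|exact: A0|].
apply: (negligibleS _ nA) => u /= /not_implyP[Su]; apply: contra_notP => nAu e e0.
have [p pe] : exists p, p.+1%:R^-1 < e.
  have [N _ HN] := near_infty_natSinv_lt (PosNum e0).
  by exists N; apply: HN => /=.
apply: contra_notP nAu => nf; exists p => //; split => // m.
rewrite leNgt; apply/negP => fm; apply: nf; exists m.
exact: lt_trans fm pe.
Qed.

(** Dominated convergence for the excess [max(|f m| - eps, 0)], which tends to 0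
    almost everywhere. Only an asymptotic bound is asked of [f]: its pointwise
    limit will involve the maximizer of a linear form, whose measurability in
    the form is thus never at stake. *)
Lemma Rintegral_small (f : nat -> V -> R) (C eps : R) : 0 <= eps ->
  (forall m, continuous (f m)) -> (forall m u, S u -> `|f m u| <= C) ->
  {ae sigma, forall u, S u -> forall e, eps < e ->
    \forall m \near \oo, `|f m u| <= e} ->
  forall e, eps < e -> \forall m \near \oo, `|\int[sigma]_(u in S) f m u| <= e.
Proof.
move=> eps0 cf fC fae e eeps.
pose g m u := Num.max (`|f m u| - eps) 0.
have cg m : continuous (g m) by exact: continuous_excess.
have C0 u : S u -> 0 <= C by move=> Su; exact: le_trans (fC 0%N u Su).
have Ig : (fun m => \int[sigma]_(u in S) g m u) @ \oo --> 0.
  have [|||||_ _] := @dominated_convergence _ _ _ sigma S sphere_measurable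
     (fun m => EFin \o g m) (cst 0%E) (cst C%:E).
  - move=> m; apply/measurable_EFinP; apply: measurable_funTS.
    exact: continuous_borel_measurable.
  - exact: measurable_cst.
  - apply: (negligibleS _ fae) => u; apply: contra_not => fu Su.
    apply: cvg_EFin; first exact: nearW.
    apply/cvgrPdist_le => r r0.
    have := fu Su (eps + r); rewrite ltrDl => /(_ r0).
    apply: filterS => m fm; rewrite sub0r normrN /= /g ger0_norm.
      by rewrite ge_max (ltW r0) andbT lerBlDl.
    by rewrite le_max lexx orbT.
  - apply: (continuous_integrable (g := cst C)); exact: cst_continuous.
  - apply: aeW => u m Su; rewrite /= lee_fin /g ger0_norm.
      by rewrite ge_max (C0 u Su) andbT lerBlDr (le_trans (fC m u Su))// lerDl.
    by rewrite le_max lexx orbT.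
  by rewrite integral0 => /fine_cvg.
have : \forall m \near \oo, \int[sigma]_(u in S) g m u <= e - eps.
  by apply: (cvgr_le _ Ig); rewrite subr_gt0.
apply: filterS => m Hm.
apply: le_trans.
  exact: (le_normr_Rintegral sphere_measurable (continuous_integrable (cf m))).
apply: (@le_trans _ _ (\int[sigma]_(u in S) (g m u + eps))).
  apply: le_Rintegral => //.
  - exact: sphere_measurable.
  - by apply: (continuous_integrable (g := fun u => `|f m u|));
      exact: continuous_normr.
  - by apply: (continuous_integrable (g := fun u => g m u + eps));
      exact: continuous_addr.
  - by move=> u Su; rewrite -lerBlDr /g le_max lexx.
rewrite RintegralD ?Rintegral_sphere_cst -?lerBrDr//.
- exact: sphere_measurable.
- exact: continuous_integrable.
- apply: (continuous_integrable (g := cst eps)); exact: cst_continuous.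
Qed.

End SphereIntegral.

(** * Almost every direction has a unique maximizer *)

Section UniqueMaximizer.
Context {R : realType} {d : nat}.
Local Notation V := 'rV[R]_d.
Local Notation S := (@unit_sphere R d).

Lemma dot_delta (v : V) i : dot (delta_mx 0 i) v = v 0 i.
Proof.
rewrite /dot (bigD1 i)//= big1 => [|j ji]; first by rewrite mxE !eqxx mul1r addr0.
by rewrite mxE (negbTE ji) andbF mul0r.
Qed.

Lemma dot_mul_delta (u v : V) a b :
  dot v (u *m delta_mx a b) = u 0 a * v 0 b.
Proof.
rewrite /dot (bigD1 b)//= big1 => [|i ib].
  rewrite mxE (bigD1 a)//= big1 => [|i ia]; last first.
    by rewrite mxE (negbTE ia) mulr0.
  by rewrite mxE !eqxx mulr1 !addr0 mulrC.
rewrite mxE big1 ?mulr0// => k _.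
by rewrite mxE (negbTE ib) andbF mulr0.
Qed.

Lemma dot_plane_proj (u v : V) a b :
  dot v (u *m plane_proj a b) = u 0 a * v 0 a + u 0 b * v 0 b.
Proof. by rewrite /plane_proj mulmxDr dotDr !dot_mul_delta. Qed.

Lemma dot_plane_gen (u v : V) a b :
  dot v (u *m plane_gen a b) = u 0 a * v 0 b - u 0 b * v 0 a.
Proof. by rewrite /plane_gen mulmxBr dotBr !dot_mul_delta. Qed.

Lemma dot_plane_rot (u v : V) a b s : dot v (u *m plane_rot a b s) =
  dot v u + (cos s - 1) * dot v (u *m plane_proj a b)
  + sin s * dot v (u *m plane_gen a b).
Proof.
by rewrite /plane_rot 2!mulmxDr mulmx1 -!scalemxAr 2!dotDr !dotZr.
Qed.

(** The first hypothesis makes [w] a multiple of [u]. *)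
Lemma parallel_orthogonal_eq0 (u w : V) : unit_sphere u ->
  (forall i j, u 0 i * w 0 j = u 0 j * w 0 i) -> dot w u = 0 -> w = 0.
Proof.
move=> u1 par wu; apply/rowP => j; rewrite [RHS]mxE.
rewrite -(mulr1 (w 0 j)) -u1 -[RHS](mulr0 (u 0 j)) -wu /dot !mulr_sumr.
by apply: eq_bigr => i _; rewrite mulrCA mulrA par -mulrA.
Qed.

Lemma ex_maximizer (K : set V) u : compact K -> K !=set0 ->
  exists2 k, K k & forall z, K z -> dot z u <= dot k u.
Proof.
move=> cK K0.
have [|k /set_mem Kk kmax] := @compact_EVT_max _ _ (fun z => dot z u) K K0 cK.
  apply: continuous_subspaceT => z.
  by apply: dot_continuous; [exact: cvg_id|exact: cst_continuous].
by exists k => // z Kz; apply: kmax; exact: mem_set.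
Qed.

Variable sigma : probability (@borel_rV R d) R.

Lemma Rintegral_sphere_sum (I : Type) (r : seq I) (P : pred I) (f : I -> V -> R) :
  (forall i, continuous (f i)) ->
  \int[sigma]_(u in S) (\sum_(i <- r | P i) f i u) =
  \sum_(i <- r | P i) \int[sigma]_(u in S) f i u.
Proof.
move=> cf; elim: r => [|i r IHr].
  under eq_Rintegral do rewrite big_nil.
  rewrite big_nil Rintegral_cst ?mul0r//; exact: sphere_measurable.
under eq_Rintegral do rewrite big_cons.
rewrite big_cons; case: ifP => // _; rewrite -IHr RintegralD//.
- exact: sphere_measurable.
- exact: continuous_integrable.
- apply: (continuous_integrable _ (g := fun u => \sum_(i <- r | P i) f i u)).
  apply: continuous_big => //; exact: add_continuous.
Qed.

Lemma sin_invS_gt0 m : 0 < sin (m.+1%:R^-1 : R).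
Proof.
rewrite sin_gt0_pi// invr_gt0 ltr0n/= (@le_lt_trans _ _ 1)//.
  by rewrite invf_le1// ler1n.
by rewrite (@lt_le_trans _ _ 2) ?ltr1n// pi_ge2.
Qed.

(** The quotient is the tangent of half the angle. *)
Lemma half_tan_cvg0 :
  (fun m => (1 - cos (m.+1%:R^-1 : R)) / sin (m.+1%:R^-1 : R)) @ \oo --> 0.
Proof.
have s0 := sin_invS_gt0.
rewrite (_ : (fun m => _) =
   (fun m => sin (m.+1%:R^-1 : R) / (1 + cos (m.+1%:R^-1 : R)))); last first.
  apply/funext => m.
  have c0 : 1 + cos (m.+1%:R^-1 : R) != 0.
    apply/eqP => c1; have := cos2Dsin2 (m.+1%:R^-1 : R).
    have -> : cos (m.+1%:R^-1 : R) = -1 by lra.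
    by have := mulr_gt0 (s0 m) (s0 m); rewrite !expr2; lra.
  apply/eqP; rewrite eqr_div ?(lt0r_neq0 (s0 m))//; apply/eqP.
  have -> : sin (m.+1%:R^-1 : R) * sin m.+1%:R^-1 = 1 - cos m.+1%:R^-1 ^+ 2.
    by have := cos2Dsin2 (m.+1%:R^-1 : R); rewrite -expr2; lra.
  ring.
have cvgd : (fun m => m.+1%:R^-1 : R) @ \oo --> (0 : R) by exact: cvg_harmonic.
rewrite [X in _ --> X](_ : 0 = sin 0 / (1 + cos (0 : R))); last first.
  by rewrite sin0 mul0r.
apply: cvgM.
  by apply: (cvg_comp _ _ cvgd); exact: continuous_sin.
apply: cvgV; first by rewrite cos0.
apply: cvgD; first exact: cvg_cst.
by apply: (cvg_comp _ _ cvgd); exact: continuous_cos.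
Qed.

Hypothesis hsigma : rotation_invariant_on_sphere sigma.

(** Let [k] and [k'] be two maximizers at [u] and let [Q s] be the rotation by [s]
    in a coordinate plane, with generator [A]. Testing the support function [h]
    at [u Q(s)] with [k] and at [u Q(-s)] with [k'] gives
      [h (u Q(s)) + h (u Q(-s)) - 2 h u + c (1 - cos s) >= sin s <k - k', u A>]
    for some constant [c]. By invariance the left-hand side integrates to
    [c (1 - cos s)], which is negligible with respect to [sin s]. So almost
    everywhere [k - k'] is orthogonal to all [u A]; it is orthogonal to [u] as
    well, and hence it is zero. This replaces the almost everywhere
    differentiability of the convex function [h] on the sphere. *)
Lemma ae_exposed (K : set V) M : compact K -> K !=set0 ->
    (forall z, K z -> `|z| <= M) ->
  {ae sigma, forall u, S u -> exists k, exposed K u k}.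
Proof.
move=> cK K0 KM.
set h := support_function K.
have ch : continuous h by exact: support_continuous KM.
pose dl m : R := m.+1%:R^-1.
have s0 m : 0 < sin (dl m) by exact: sin_invS_gt0.
(* [4 * M] bounds [<k + k', u P>], the coefficient of [1 - cos s]. *)
pose gap (p : 'I_d * 'I_d) m u :=
  (h (u *m plane_rot p.1 p.2 (dl m)) + h (u *m plane_rot p.1 p.2 (- dl m))
   + (- 2 * h u + 4 * M * (1 - cos (dl m)))) * (sin (dl m))^-1.
have gapP p m u k k' : S u -> K k -> K k' ->
    (forall z, K z -> dot z u <= dot k u) ->
    (forall z, K z -> dot z u <= dot k' u) ->
  dot (k - k') (u *m plane_gen p.1 p.2) <= gap p m u.
  move=> Su Kk Kk' kmax kmax'; rewrite /gap ler_pdivlMr//.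
  have h1 := support_ge (u *m plane_rot p.1 p.2 (dl m)) KM Kk.
  have h2 := support_ge (u *m plane_rot p.1 p.2 (- dl m)) KM Kk'.
  have := support_max KM Kk kmax; have := support_max KM Kk' kmax'.
  move: h1 h2; rewrite !dot_plane_rot cosN sinN dotBl -/h.
  have projM z : K z -> dot z (u *m plane_proj p.1 p.2) <= 2 * M.
    move=> Kz; rewrite dot_plane_proj (le_trans (ler_norm _))//.
    rewrite (le_trans (ler_normD _ _))// mulr_natl mulr2n.
    have uz i : `|u 0 i * z 0 i| <= M.
      rewrite normrM -[leRHS]mul1r ler_pM//.
        by rewrite (le_trans (ler_coord_norm _ _))// sphere_norm.
      by rewrite (le_trans (ler_coord_norm _ _))// KM.
    by rewrite lerD.
  have c1 : 0 <= 1 - cos (dl m) by rewrite subr_ge0 cos_le1.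
  have := ler_wpM2l c1 (projM k Kk); have := ler_wpM2l c1 (projM k' Kk').
  lra.
(* All the planes are treated at once by summing their nonnegative gaps. *)
pose F m u := \sum_(p : 'I_d * 'I_d | p.1 != p.2) gap p m u.
have gap0 p m u : S u -> 0 <= gap p m u.
  move=> Su; have [k Kk kmax] := ex_maximizer u cK K0.
  by have := gapP p m u k k Su Kk Kk kmax kmax; rewrite subrr dot0l.
have chr (p : 'I_d * 'I_d) s :
    continuous (fun u : V => h (u *m plane_rot p.1 p.2 s)).
  move=> u; apply: (@continuous_comp _ _ _ (fun u : V => u *m _) h); last exact: ch.
  exact: mulmx_continuous.
have cgap p m : continuous (gap p m).
  apply: continuous_mulr; apply: continuous_add; first exact: continuous_add.
  by apply: continuous_addr; exact: continuous_mull.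
have int g : continuous g -> sigma.-integrable S (EFin \o g).
  exact: continuous_integrable.
have mS := @sphere_measurable R d.
have Igap p m : p.1 != p.2 -> \int[sigma]_(u in S) gap p m u =
    4 * M * ((1 - cos (dl m)) / sin (dl m)).
  move=> pp; rewrite RintegralZr//; last first.
    apply: int; apply: continuous_add; first exact: continuous_add.
    by apply: continuous_addr; exact: continuous_mull.
  rewrite RintegralD//; last 2 first.
  - by apply: (int (fun u => _ + _)); exact: continuous_add.
  - by apply: (int (fun u => _ + _)); apply: continuous_addr; exact: continuous_mull.
  rewrite RintegralD//; [|exact: int|exact: int].
  rewrite (Rintegral_rotation hsigma (plane_rotP pp _) ch).
  rewrite (Rintegral_rotation hsigma (plane_rotP pp _) ch).
  rewrite RintegralD//; last 2 first.
  - by apply: int; exact: continuous_mull.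
  - by apply: (int (cst _)); exact: cst_continuous.
  rewrite Rintegral_sphere_cst// RintegralZl//; last exact: int.
  lra.
have : {ae sigma, forall u, S u -> forall e, 0 < e -> exists m, F m u < e}.
  apply: ae_small_of_Rintegral.
  - by move=> m; apply: continuous_big => [|p _]; [exact: add_continuous|].
  - by move=> m u Su; apply: sumr_ge0 => p _; exact: gap0.
  - rewrite (_ : (fun m => _) = (fun m => (\sum_(p : 'I_d * 'I_d | p.1 != p.2)
        4 * M) * ((1 - cos (dl m)) / sin (dl m)))); last first.
      apply/funext => m; rewrite Rintegral_sphere_sum; last by move=> p; exact: cgap.
      by rewrite mulr_suml; apply: eq_bigr => p pp; rewrite Igap.
    rewrite -[X in _ --> X](mulr0 (\sum_(p : 'I_d * 'I_d | p.1 != p.2) 4 * M)).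
    by apply: cvgM; [exact: cvg_cst|exact: half_tan_cvg0].
move=> H; apply: (negligibleS _ H) => u; apply: contra_not => {}H Su.
have [k Kk kmax] := ex_maximizer u cK K0.
exists k; split => // z Kz zk; rewrite lt_neqAle kmax// andbT.
apply: contra_neq zk => zu; apply/eqP; rewrite -subr_eq0; apply/eqP.
have zmax x : K x -> dot x u <= dot z u by move=> Kx; rewrite zu kmax.
have le_gen i j x y : i != j -> K x -> K y ->
    (forall z, K z -> dot z u <= dot x u) ->
    (forall z, K z -> dot z u <= dot y u) ->
    dot (x - y) (u *m plane_gen i j) <= 0.
  move=> ij Kx Ky xmax ymax; apply/ler_addgt0Pr => e e0; rewrite add0r.
  have [m Fe] := H Su e e0; apply: le_trans (ltW Fe).
  apply: le_trans (gapP (i, j) m u x y Su Kx Ky xmax ymax) _.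
  by rewrite /F (bigD1 (i, j))//= lerDl sumr_ge0// => p _; exact: gap0.
apply: (parallel_orthogonal_eq0 Su); last by rewrite dotBl zu subrr.
move=> i j; have [->//|ij] := eqVneq i j.
have := le_gen i j z k ij Kz Kk zmax kmax.
have := le_gen i j k z ij Kk Kz kmax zmax.
rewrite !dot_plane_gen !mxE; lra.
Qed.

End UniqueMaximizer.

(** * Mean value theorem and symmetry of second derivatives *)

Section Calculus.
Context {R : realType}.

Lemma mean_value (F dF : R -> R) (a b : R) : a < b ->
  (forall x, a <= x <= b -> is_derive x 1 F (dF x)) ->
  exists2 c, a <= c <= b & F b - F a = dF c * (b - a).
Proof.
move=> ab FdF.
have [x|x xab|c] := @MVT _ F dF a b ab.
- by rewrite in_itv/= => /andP[ax xb]; apply: FdF; rewrite !ltW.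
- apply: derivable_within_continuous => y; rewrite in_itv/= => yab.
  by case: (FdF y yab).
- by rewrite in_itv/= => /andP[ac cb]; exists c; rewrite ?ltW.
Qed.

Lemma mean_value_bound (F dF : R -> R) (t e : R) :
  (forall x : R, `|x| <= `|t| -> is_derive x 1 F (dF x)) ->
  (forall x : R, `|x| <= `|t| -> `|dF x| <= e) -> `|F t - F 0| <= e * `|t|.
Proof.
move=> FdF dFe; have [t0|t0|->] := ltgtP t 0; last first.
- by rewrite subrr normr0 mulr0.
- have [x x0t|c c0t ->] := @mean_value F dF 0 t t0.
    by apply: FdF; rewrite !ger0_norm//; lra.
  rewrite subr0 normrM ler_wpM2r// dFe// !ger0_norm//; lra.
- have [x x0t|c c0t] := @mean_value F dF t 0 t0.
    by apply: FdF; rewrite !ler0_norm//; lra.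
  rewrite distrC => ->; rewrite sub0r normrM normrN ler_wpM2r// dFe//.
  rewrite !ler0_norm//; lra.
Qed.

Context {W : normedModType R}.
Implicit Types (f g : W -> R) (x y u v : W).

Lemma is_derive_line (Z : normedModType R) (f : W -> Z) y u (a : R) (df : Z) :
  is_derive (y + a *: u) u f df ->
  is_derive a 1 (fun b => f (y + b *: u)) df.
Proof.
move=> [dfu <-]; have E : (fun h => h^-1 *: (((fun b => f (y + b *: u)) \o
      shift a) (h *: 1) - f (y + a *: u))) =
    (fun h => h^-1 *: ((f \o shift (y + a *: u)) (h *: u) - f (y + a *: u))).
  by apply/funext => h /=; rewrite [_ *: 1]mulr1 scalerDl addrCA.
by split; [rewrite /derivable E|rewrite /derive E].
Qed.

Lemma differentiable_expansion g x e : differentiable g x -> 0 < e ->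
  \forall w \near 0, `|g (x + w) - g x - 'd g x w| <= e * `|w|.
Proof.
move=> dg e0; have /eqaddoP/(_ e e0) := diff_locally dg.
by apply: filterS => w /=; rewrite -addrA -opprD (addrC x).
Qed.

(** By the mean value theorem in direction [u], the second difference is [h] times
    an increment of the partial derivative [g] along [h *: v], and [g] has a
    linear expansion at [x]. *)
Lemma second_difference f g x u v :
  (\forall y \near x, is_derive y u f (g y)) -> differentiable g x ->
  forall e, 0 < e -> \forall h \near 0^'+,
    `|f (x + h *: v + h *: u) - f (x + h *: u) - (f (x + h *: v) - f x)
      - h * h * 'd g x v| <= e * (h * h).
Proof.
move=> fg dg e e0.
pose c := 2 * `|u| + `|v| + 1.
have c0 : 0 < c by rewrite ltr_wpDl// addr_ge0// mulr_ge0.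
have [r /= r0 Hr] : exists2 r, 0 < r & forall w, `|w| < r ->
    is_derive (x + w) u f (g (x + w)) /\
    `|g (x + w) - g x - 'd g x w| <= e / c * `|w|.
  have H1 : \forall w \near (0 : W), is_derive (x + w) u f (g (x + w)).
    have cx : (fun w => x + w) @ (0 : W) --> x + 0.
      by apply: cvgD; [exact: cvg_cst|exact: cvg_id].
    by rewrite addr0 in cx; exact: cx fg.
  have H2 := differentiable_expansion dg (divr_gt0 e0 c0).
  have [r /= r0 Hr] := (nbhs_normP _ _).1 (filterI H1 H2).
  by exists r => // w wr; apply: Hr; rewrite /ball_ /= sub0r normrN.
near=> h.
have h0 : 0 < h by [].
have hc : h * c < r.
  rewrite -ltr_pdivlMr//; near: h; apply: nbhs_right_lt; exact: divr_gt0.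
have hu0 : 0 <= h * `|u| by rewrite mulr_ge0// ltW.
have hv0 : 0 <= h * `|v| by rewrite mulr_ge0// ltW.
have hcE : h * c = h * `|u| + h * `|u| + h * `|v| + h by rewrite /c; ring.
have small b : 0 <= b <= h ->
    `|b *: u| <= h * `|u| /\ `|h *: v + b *: u| <= h * `|v| + h * `|u|.
  move=> b0h; have bu : `|b *: u| <= h * `|u|.
    by rewrite normrZ ler_wpM2r// ger0_norm//; lra.
  split=> //; rewrite (le_trans (ler_normD _ _))// lerD// normrZ gtr0_norm//.
have [a a0h|xi xi0h] := @mean_value
    (fun a => f (x + h *: v + a *: u) - f (x + a *: u))
    (fun a => g (x + h *: v + a *: u) - g (x + a *: u)) 0 h h0.
  have [s1 s2] := small a a0h.
  apply: is_deriveB.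
  - by apply: is_derive_line; rewrite -addrA; apply: (Hr _ _).1; lra.
  - by apply: is_derive_line; apply: (Hr _ _).1; lra.
rewrite !scale0r !addr0 subr0 => ->.
have [s1 s2] := small xi xi0h.
have [_ e1] := Hr (h *: v + xi *: u) ltac:(lra).
have [_ e2] := Hr (xi *: u) ltac:(lra).
have dE : 'd g x (h *: v + xi *: u) = h * 'd g x v + 'd g x (xi *: u).
  by rewrite linearD linearZ.
rewrite -(addrA x (h *: v)).
rewrite dE in e1.
have -> : (g (x + (h *: v + xi *: u)) - g (x + xi *: u)) * h - h * h * 'd g x v =
    h * ((g (x + (h *: v + xi *: u)) - g x - (h * 'd g x v + 'd g x (xi *: u)))
    - (g (x + xi *: u) - g x - 'd g x (xi *: u))) by ring.
rewrite normrM gtr0_norm// [leRHS]mulrCA ler_wpM2l ?(ltW h0)//.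
rewrite (le_trans (ler_normB _ _))//.
apply: (@le_trans _ _ (e / c * (h * c))); last first.
  by rewrite mulrCA mulrC divfK ?gt_eqF.
have ec0 : 0 <= e / c by rewrite ltW// divr_gt0.
have w12 : `|h *: v + xi *: u| + `|xi *: u| <= h * c by lra.
apply: le_trans (ler_wpM2l ec0 w12); rewrite mulrDr lerD.
Unshelve. all: by end_near. Qed.

(** The second difference is symmetric in [u] and [v]. *)
Lemma schwarz f gu gv x u v :
  (\forall y \near x, is_derive y u f (gu y)) ->
  (\forall y \near x, is_derive y v f (gv y)) ->
  differentiable gu x -> differentiable gv x -> 'd gu x v = 'd gv x u.
Proof.
move=> fgu fgv dgu dgv; apply/eqP; rewrite -subr_eq0 -normr_le0.
apply/ler_addgt0Pr => e e0; rewrite add0r.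
have e20 : 0 < e / 2 by rewrite divr_gt0.
near (0 : R)^'+ => h.
have h0 : 0 < h by [].
have : `|f (x + h *: v + h *: u) - f (x + h *: u) - (f (x + h *: v) - f x)
      - h * h * 'd gu x v| <= e / 2 * (h * h).
  by near: h; exact: second_difference.
have : `|f (x + h *: u + h *: v) - f (x + h *: v) - (f (x + h *: u) - f x)
      - h * h * 'd gv x u| <= e / 2 * (h * h).
  by near: h; exact: second_difference.
rewrite (addrAC x (h *: u)).
set a := f _; set b := f _; set c := f _; set d := f _ => H1 H2.
rewrite -(ler_pM2l (mulr_gt0 h0 h0)) -[X in X * `|_|]gtr0_norm ?mulr_gt0// -normrM.
have -> : h * h * ('d gu x v - 'd gv x u) =
  (a - b - (c - d) - h * h * 'd gv x u) - (a - c - (b - d) - h * h * 'd gu x v).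
  ring.
by rewrite (le_trans (ler_normB _ _))//; lra.
Unshelve. all: by end_near. Qed.

Lemma uniform_near0 (P : topologicalType) (C : set P) (f : R -> P -> R) :
  compact C ->
  (forall p, C p -> {for (p, 0 : R), continuous (fun q : P * R => f q.2 q.1)}) ->
  forall e, 0 < e -> \forall h \near (0 : R), forall p, C p ->
    `|f h p - f 0 p| <= e.
Proof.
move=> cC cf e e0; have cover := (compact_near_coveringP C).1 cC.
apply: (cover R (nbhs (0 : R)) (fun h p => `|f h p - f 0 p| <= e)) => p Cp.
have e20 : 0 < e / 2 by rewrite divr_gt0.
have /cvgrPdist_le/(_ _ e20) := cf p Cp.
move=> [[A B] /= [Ap B0] AB]; exists (A, B) => // -[q h] /= [Aq Bh].
have e1 := AB (q, h) (conj Aq Bh).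
have e2 := AB (q, 0) (conj Aq (nbhs_singleton B0)).
have -> : f h q - f 0 q = (f 0 p - f 0 q) - (f 0 p - f h q) by ring.
rewrite (le_trans (ler_normB _ _))// (splitr e) lerD//.
Qed.

End Calculus.

(** * The velocity of a path of symplectomorphisms *)

Lemma continuous_pairr (S T : topologicalType) (a : S) :
  continuous (fun x : T => (a, x)).
Proof. by move=> x; apply: cvg_pair; [exact: cvg_cst|exact: cvg_id]. Qed.

Section SmoothPath.
Context {R : realType} {d : nat}.
Local Notation V := 'rV[R]_d.
Variables (I : set R) (phi : R -> V -> V).
Hypotheses (oI : open I) (I0 : I 0).

Let Phi (p : R * V) := phi p.1 p.2.
Hypothesis smoothPhi : smooth_on (I `*` setT) Phi.

Let differentiable_Phi p : I p.1 -> differentiable Phi p.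
Proof. by move=> Ip; have [+ _] := smoothPhi 1; exact. Qed.

Let differentiable_DPhi w p : I p.1 -> differentiable ('D_w Phi) p.
Proof. by move=> Ip; have [_ /(_ w)[+ _]] := smoothPhi 2; exact. Qed.

Let continuous_DDPhi w w' p : I p.1 -> {for p, continuous ('D_w' ('D_w Phi))}.
Proof.
by move=> Ip; have [_ /(_ w)[_ /(_ w')]] := smoothPhi 2; apply.
Qed.

Let is_derive_coord w p i : I p.1 ->
  is_derive p w (fun q => Phi q 0 i) ('D_w Phi p 0 i).
Proof.
move=> Ip; have dP : derivable Phi p w.
  by apply: diff_derivable; exact: differentiable_Phi.
by split; [exact: (derivable_mxP Phi p w).1|rewrite derive_mx// mxE].
Qed.

Definition velocity (z : V) : V := 'D_(1, 0) Phi (0, z).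

Lemma near_in_domain (z : V) : \forall p \near (0, z), I p.1.
Proof.
exists (I, setT) => /=; first by split; [exact: open_nbhs_nbhs|exact: filterT].
by move=> [t x] [].
Qed.

Lemma differentiable_slice (g : R * V -> V) z : differentiable g (0, z) ->
  differentiable (fun x => g (0, x)) z.
Proof.
move=> dg; apply: (@differentiable_comp _ _ _ _ (fun x : V => (0 : R, x)) g) => //.
Qed.

Lemma derive_slice (W : normedModType R) (g : R * V -> W) t z v :
  'D_v (fun x => g (t, x)) z = 'D_(0, v) g (t, z).
Proof.
have E : (fun h : R =>
      h^-1 *: (((fun x => g (t, x)) \o shift z) (h *: v) - g (t, z))) =
    (fun h => h^-1 *: ((g \o shift (t, z)) (h *: ((0 : R), v)) - g (t, z))).
  by apply/funext => h /=; congr (_ *: (g (_, _) - _)); rewrite /= scaler0 add0r.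
by rewrite /derive E.
Qed.

Lemma differentiable_velocity z : differentiable velocity z.
Proof.
apply: (@differentiable_slice ('D_(1, 0) Phi)).
exact: (@differentiable_DPhi (1, 0) (0, z)).
Qed.

Lemma derive_velocity_continuous v : continuous ('D_v velocity).
Proof.
move=> z.
have -> : 'D_v velocity = (fun x => 'D_(0, v) ('D_(1, 0) Phi) (0, x)).
  by apply/funext => x; exact: (derive_slice ('D_(1, 0) Phi)).
apply: (@continuous_comp _ _ _ (fun x : V => (0 : R, x))
  ('D_(0, v) ('D_(1, 0) Phi))).
  exact: continuous_pairr.
exact: (@continuous_DDPhi (1, 0) (0, v) (0, z)).
Qed.

(** The mean value theorem in the time variable bounds the remainder by the
    oscillation in time of the time derivative, which is continuous, hence
    uniformly small near the compact set [{0} x K]. *)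
Lemma velocity_first_order K : compact K -> (forall z, phi 0 z = z) ->
  first_order K phi velocity.
Proof.
move=> cK phi0 e e0.
have cover := (compact_near_coveringP K).1 cK.
apply: (cover R (nbhs (0 : R))
  (fun t k => `|phi t k - k - t *: velocity k| <= e * `|t|)).
move=> z Kz.
have e20 : 0 < e / 2 by rewrite divr_gt0.
have cD : {for (0, z), continuous ('D_(1, 0) Phi)}.
  apply: differentiable_continuous; exact: (@differentiable_DPhi (1, 0) (0, z)).
have /cvgrPdist_le/(_ _ e20) near1 := cD.
have [[A B] [/= A0 Bz] AB] := filterI near1 (near_in_domain z).
have [r /= r0 rA] := (nbhs_normP _ _).1 A0.
exists (B, [set t | `|t| < r]); first split => //=.
  by apply/nbhs_normP; exists r => // t; rewrite /= sub0r normrN.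
move=> [x t] [/= Bx tr].
have inA s : `|s| <= `|t| -> A s.
  by move=> st; apply: rA; rewrite /= sub0r normrN; exact: le_lt_trans st tr.
rewrite [leLHS]/Num.Def.normr/= mx_normrE; apply: bigmax_le => [|[i j] _ /=].
  by rewrite mulr_ge0// ltW.
rewrite ord1 !mxE.
have -> : phi t x 0 j - x 0 j - t * velocity x 0 j =
    (phi t x 0 j - t * velocity x 0 j) - (phi 0 x 0 j - 0 * velocity x 0 j).
  by rewrite phi0; ring.
apply: (@mean_value_bound _ (fun s => phi s x 0 j - s * velocity x 0 j)
  (fun s => 'D_(1, 0) Phi (s, x) 0 j - velocity x 0 j)) => s st.
- have [_ Is] := AB (s, x) (conj (inA s st) Bx).
  apply: is_deriveB.
    have := @is_derive_coord (1, 0) (s, x) j Is.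
    have -> : (s, x) = (0, x) + s *: (1, 0) :> R * V.
      by congr pair; rewrite /= ?scaler0 ?addr0// add0r [_ *: _]mulr1.
    move=> /is_derive_line; congr is_derive.
    by apply/funext => b; rewrite /Phi /= scaler0 addr0 add0r [_ *: _]mulr1.
  by apply: is_derive_eq; rewrite scaler0 add0r [LHS]mulr1.
- have [e1 _] := AB (s, x) (conj (inA s st) Bx).
  have [e2 _] := AB (0, x) (conj (nbhs_singleton A0) Bx).
  apply: (@le_trans _ _ `|'D_(1, 0) Phi (s, x) - velocity x|).
    by rewrite (le_trans _ (ler_coord_norm _ j))// !mxE.
  rewrite (_ : _ - _ = ('D_(1, 0) Phi (0, z) - 'D_(1, 0) Phi (0, x)) -
    ('D_(1, 0) Phi (0, z) - 'D_(1, 0) Phi (s, x))).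
    apply: (le_trans (ler_normB _ _)); rewrite (splitr e).
    by apply: lerD; [exact: e2|exact: e1].
  by rewrite opprB [RHS]addrC addrA subrK.
Qed.

(** The derivatives in time and in space commute. *)
Lemma is_derive_jacobian (v z : V) i :
  is_derive (0 : R) 1 (fun t => 'D_v (phi t) z 0 i) ('D_v velocity z 0 i).
Proof.
pose gv (p : R * V) := 'D_(0, v) Phi p 0 i.
pose gu (p : R * V) := 'D_(1, 0) Phi p 0 i.
have dcoord w : differentiable (fun p => 'D_w Phi p 0 i : R) (0, z).
  apply: (@differentiable_comp _ _ _ _ ('D_w Phi) (fun u : V => u 0 i)).
    exact: differentiable_DPhi.
  exact: differentiable_coord.
have near_coord w : \forall p \near ((0 : R), z),
    is_derive p w (fun q => Phi q 0 i) ('D_w Phi p 0 i).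
  by apply: filterS (near_in_domain z) => p Ip; exact: is_derive_coord.
have mixed : 'd gu (0, z) (0, v) = 'd gv (0, z) (1, 0).
  apply: (@schwarz _ _ (fun q => Phi q 0 i)).
  - exact: near_coord.
  - exact: near_coord.
  - exact: dcoord.
  - exact: dcoord.
have -> : 'D_v velocity z 0 i = 'd gv (0, z) (1, 0).
  have dX : derivable velocity z v.
    by apply: diff_derivable; exact: differentiable_velocity.
  rewrite -mixed -deriveE; last exact: dcoord.
  by rewrite -(derive_slice gu) derive_mx// mxE.
have -> : (fun t => 'D_v (phi t) z 0 i) = (fun t => gv ((0, z) + t *: (1, 0))).
  apply/funext => t.
  have -> : ((0 : R), z) + t *: (1, 0) = (t, z).
    by congr pair; rewrite /= ?scaler0 ?addr0// add0r [_ *: _]mulr1.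
  by rewrite (derive_slice Phi).
apply: is_derive_line; rewrite scale0r addr0.
apply: DeriveDef; first by apply: diff_derivable; exact: dcoord.
by rewrite deriveE//; exact: dcoord.
Qed.

End SmoothPath.

Section SymplecticPath.
Context {R : realType} {n : nat}.
Local Notation V := 'rV[R]_(n + n).
Variables (I : set R) (phi : R -> V -> V).
Hypotheses (oI : open I) (I0 : I 0).
Hypotheses (sphi : smooth_symp_path I phi) (phi0 : forall z, phi 0 z = z).

(** Differentiating the symplectic condition at the identity shows that the
    derivative of the velocity lies in the symplectic Lie algebra; applied to
    the two vectors of a coordinate symplectic plane, this says that its trace
    on that plane is zero. *)
Lemma velocity_divergence_free z j :
  'D_(delta_mx 0 (lshift n j)) (velocity phi) z 0 (lshift n j) +
  'D_(delta_mx 0 (rshift n j)) (velocity phi) z 0 (rshift n j) = 0.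
Proof.
pose a := lshift n j; pose b := rshift n j.
pose ea : V := delta_mx 0 a; pose eb : V := delta_mx 0 b.
pose A t := 'D_ea (phi t) z; pose B t := 'D_eb (phi t) z.
have dA i := is_derive_jacobian oI I0 sphi.2 ea z i.
have dB i := is_derive_jacobian oI I0 sphi.2 eb z i.
have A0 : A 0 = ea.
  by rewrite /A (_ : phi 0 = id) ?derive_id//; apply/funext.
have B0 : B 0 = eb.
  by rewrite /B (_ : phi 0 = id) ?derive_id//; apply/funext.
have symp t : I t -> symplectic_form (A t) (B t) = symplectic_form ea eb.
  move=> It; have [smt _ sympt] := sphi.1 t It; rewrite -[RHS](sympt z).
  have dphi : differentiable (phi t) z by have [+ _] := smt 1; exact.
  by rewrite /A /B !deriveE.
pose da i : R := 'D_ea (velocity phi) z 0 i.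
pose db i : R := 'D_eb (velocity phi) z 0 i.
pose form l := (fun t => A t 0 (lshift n l)) * (fun t => B t 0 (rshift n l))
  - (fun t => A t 0 (rshift n l)) * (fun t => B t 0 (lshift n l)).
have dform l : is_derive (0 : R) 1 (form l) (if l == j then da a + db b else 0).
  have dAx := dA (lshift n l); have dAy := dA (rshift n l).
  have dBx := dB (lshift n l); have dBy := dB (rshift n l).
  apply: is_derive_eq; rewrite A0 B0 !mxE /= !eq_lshift !eq_rshift.
  rewrite eq_lrshift eq_rlshift /= !scale0r !addr0 subr0.
  case: eqVneq => [->|_]; last by rewrite !scale0r addr0.
  by rewrite !scale1r addrC.
have dsum : is_derive (0 : R) 1 (\sum_(l < n) form l) (da a + db b).
  apply: is_derive_eq; rewrite -big_mkcond /=.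
  by rewrite (big_pred1 j)// => l; rewrite eq_sym.
have [_ <-] := dsum.
rewrite (@near_eq_derive _ _ _ _ (cst (symplectic_form ea eb))) ?derive_cst//.
apply: filterS (open_nbhs_nbhs (conj oI I0)) => t It.
by rewrite -(symp t It) fct_sumE.
Qed.

End SymplecticPath.

(** * Flux through the orbits of the torus *)

Section RowDerivatives.
Context {R : realType} {d : nat}.
Local Notation V := 'rV[R]_d.
Implicit Types (f : R -> V) (s : R).

Lemma is_derive_rowP f s (df : V) :
  is_derive s 1 f df <-> forall i, is_derive s 1 (fun t => f t 0 i) (df 0 i).
Proof.
split=> [[fs <-] i|fi].
  by split; [exact: (derivable_mxP f s 1).1|rewrite derive_mx// mxE].
have fs : derivable f s 1.
  by apply/derivable_mxP => i j; rewrite ord1; case: (fi j).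
split=> //; rewrite derive_mx//; apply/rowP => i; rewrite mxE.
by case: (fi i).
Qed.

Lemma is_derive_dot f g s (df dg : V) :
  is_derive s 1 f df -> is_derive s 1 g dg ->
  is_derive s 1 (fun t => dot (f t) (g t)) (dot df (g s) + dot (f s) dg).
Proof.
move=> /is_derive_rowP dfi /is_derive_rowP dgi.
pose h i := (fun t => f t 0 i) * (fun t => g t 0 i).
have -> : (fun t => dot (f t) (g t)) = \sum_(i < d) h i.
  by apply/funext => t; rewrite fct_sumE.
have dh i : is_derive s 1 (h i) (df 0 i * g s 0 i + f s 0 i * dg 0 i).
  have ? := dfi i; have ? := dgi i; apply: is_derive_eq.
  by rewrite addrC; congr (_ + _); rewrite [LHS]mulrC.
have -> : dot df (g s) + dot (f s) dg =
    \sum_(i < d) (df 0 i * g s 0 i + f s 0 i * dg 0 i).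
  by rewrite big_split.
exact: is_derive_sum.
Qed.

Lemma is_derive_comp_diff (W : normedModType R) (F : V -> W) f s (df : V) :
  differentiable F (f s) -> is_derive s 1 f df ->
  is_derive s 1 (F \o f) ('d F (f s) df).
Proof.
move=> dF [/derivable1_diffP fs <-].
have dFf : differentiable (F \o f) s by exact: differentiable_comp.
split; first exact/derivable1_diffP.
by rewrite !deriveE// diff_comp.
Qed.

End RowDerivatives.

Lemma is_derive_trig (R : realType) (c0 c1 c2 s : R) :
  is_derive s 1 (fun t => c0 + (cos t - 1) * c1 + sin t * c2)
    (- sin s * c1 + cos s * c2).
Proof.
have H (x y : R) : 0 + (c1 *: (- x - 0) + c2 *: y) = - x * c1 + y * c2.
  by rewrite add0r subr0; congr (_ + _); exact: mulrC.
rewrite -H.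
have dcos := is_derive_cos s.
have dsin := is_derive_sin s.
have -> : (fun t => c0 + (cos t - 1) * c1 + sin t * c2) =
    cst c0 + (c1 *: (cos - cst 1 : R -> R) + c2 *: (sin : R -> R)).
  by apply/funext => t; rewrite -addrA; congr (_ + (_ + _)); exact: mulrC.
have d1 : is_derive s 1 (cos - cst 1 : R -> R) (- sin s - 0).
  exact: (is_deriveB dcos (is_derive_cst _ _ _)).
have d2 := is_deriveD (is_deriveZ c1 d1) (is_deriveZ c2 dsin).
exact: (is_deriveD (is_derive_cst _ _ _) d2).
Qed.

Section CircleFlux.
Context {R : realType} {d : nat}.
Local Notation V := 'rV[R]_d.
Variables (a b : 'I_d) (X : V -> V).
Hypothesis ab : a != b.
Local Notation ea := (delta_mx 0 a : V).
Local Notation eb := (delta_mx 0 b : V).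
Hypothesis dX : forall z, differentiable X z.
Hypothesis cDa : continuous ('D_ea X).
Hypothesis cDb : continuous ('D_eb X).
Hypothesis divX : forall z, 'D_ea X z 0 a + 'D_eb X z 0 b = 0.
Local Notation P := (plane_proj a b : 'M[R]_d).
Local Notation A := (plane_gen a b : 'M[R]_d).
Local Notation Q := (plane_rot a b).

Lemma rot_planeE (y : V) s : y *m P = y ->
  y *m Q s = y + (cos s - 1) *: y + sin s *: (y *m A).
Proof. by move=> yP; rewrite /plane_rot 2!mulmxDr mulmx1 -!scalemxAr yP. Qed.

Lemma is_derive_rot (y : V) (s : R) : y *m P = y ->
  is_derive s 1 (fun t => y *m Q t) (y *m Q s *m A).
Proof.
move=> yP; apply/is_derive_rowP => i.
have -> : (fun t => (y *m Q t) 0 i) =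
    (fun t => y 0 i + (cos t - 1) * y 0 i + sin t * (y *m A) 0 i).
  by apply/funext => t; rewrite rot_planeE// !mxE.
have -> : (y *m Q s *m A) 0 i = - sin s * y 0 i + cos s * (y *m A) 0 i.
  have -> : y *m Q s *m A = cos s *: (y *m A) - sin s *: y.
    rewrite rot_planeE// 2!mulmxDl -!scalemxAl -[y *m A *m A]mulmxA.
    rewrite plane_genK// mulmxN yP scalerN.
    by move: (y *m A) => v; apply/rowP => l; rewrite !mxE; ring.
  by rewrite !mxE addrC mulNr.
exact: is_derive_trig.
Qed.

(** With [e] the vector [y] of the plane rotated by [s] and [z = k + r e], this is
    the derivative of [r <X z, e>] in [r]. Its integral over [s] is the radial
    derivative of the flux of [X] through a circle of radius [r] in the plane. *)
Definition flux (k y : V) (r s : R) : R :=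
  let e := y *m Q s in let z := k + r *: e in
  dot (X z) e + r * (e 0 a * dot ('D_ea X z) e + e 0 b * dot ('D_eb X z) e).

Lemma dot_in_plane (v e : V) : e *m P = e -> dot v e = e 0 a * v 0 a + e 0 b * v 0 b.
Proof. by move=> eP; rewrite -{1}eP dot_plane_proj. Qed.

Lemma mul_plane_proj (e : V) : e *m P = e 0 a *: ea + e 0 b *: eb.
Proof.
apply/rowP => i; rewrite -[LHS]dot_delta dot_plane_proj !mxE !eqxx /=.
by rewrite !(eq_sym i).
Qed.

Lemma diff_in_plane z e : e *m P = e ->
  'd X z e = e 0 a *: 'D_ea X z + e 0 b *: 'D_eb X z.
Proof.
by move=> eP; rewrite -{1}eP mul_plane_proj linearD !linearZ !deriveE.
Qed.

Lemma rot_in_plane (y : V) s : y *m P = y -> y *m Q s *m P = y *m Q s.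
Proof.
move=> yP; rewrite rot_planeE// 2!mulmxDl -!scalemxAl yP.
by rewrite -mulmxA plane_gen_proj.
Qed.

Lemma is_derive_ray (k e : V) (r : R) : is_derive r 1 (fun t => k + t *: e) e.
Proof. by apply: (@is_derive_line _ _ _ id); exact: is_derive_id. Qed.

Lemma radius_identity (x p q e : V) (r : R) :
  dot x e + r * (e 0 a * dot p e + e 0 b * dot q e) =
  r *: (dot (e 0 a *: p + e 0 b *: q) e + dot x 0) + dot x e *: (1 : R).
Proof.
rewrite (dotC _ 0) dot0l addr0 dotDl !dotZl addrC.
by congr (_ + _); rewrite [RHS]mulr1.
Qed.

(** Since [e] and [e A] form an orthogonal frame of the plane and have the same
    length, the values on them of the quadratic form defined by [p] and [q] add
    up to the trace of that form times the square of the length of [e]. *)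
Lemma angle_identity (x p q e : V) (r : R) : e *m P = e -> p 0 a + q 0 b = 0 ->
  dot x e + r * (e 0 a * dot p e + e 0 b * dot q e) =
  - (dot ((r *: (e *m A)) 0 a *: p + (r *: (e *m A)) 0 b *: q) (e *m A)
     + dot x (- e)).
Proof.
move=> eP pq.
have eAP : e *m A *m P = e *m A by rewrite -mulmxA plane_gen_proj.
have va : (e *m A) 0 a = - e 0 b.
  rewrite -[LHS]dot_delta dot_plane_gen !mxE !eqxx /= (eq_sym b) (negbTE ab).
  by rewrite mulr0 mulr1 sub0r.
have vb : (e *m A) 0 b = e 0 a.
  rewrite -[LHS]dot_delta dot_plane_gen !mxE !eqxx /= (negbTE ab).
  by rewrite mulr0 mulr1 subr0.
have sc i : (r *: (e *m A)) 0 i = r * (e *m A) 0 i by rewrite mxE.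
rewrite dotDl !dotZl dotNr !(dot_in_plane _ eP) !(dot_in_plane _ eAP) !sc va vb.
have -> : q 0 b = - p 0 a by lra.
ring.
Qed.

Lemma is_derive_radius (k y : V) (s r : R) : y *m P = y ->
  is_derive r 1 (fun r => r * dot (X (k + r *: (y *m Q s))) (y *m Q s))
    (flux k y r s).
Proof.
move=> yP; have eP := rot_in_plane s yP.
rewrite /flux; set e := y *m Q s in eP *; set z := k + r *: e.
pose f t := dot (X (k + t *: e)) e.
have df : is_derive r 1 f (dot ('d X z e) e + dot (X z) 0).
  apply: is_derive_dot.
  by apply: is_derive_comp_diff => //; exact: is_derive_ray.
rewrite diff_in_plane// in df.
rewrite (radius_identity _ ('D_ea X z) ('D_eb X z)).
exact: (is_deriveM (f := id)).
Qed.

(** The divergence theorem in polar coordinates: for a field with trace zero on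
    the plane, the radial derivative of the flux density is also an angular
    derivative. *)
Lemma is_derive_angle (k y : V) (r s : R) : y *m P = y ->
  is_derive s 1 (fun s => - dot (X (k + r *: (y *m Q s))) (y *m Q s *m A))
    (flux k y r s).
Proof.
move=> yP; set e := fun s => y *m Q s.
have de (t : R) : is_derive t 1 e (e t *m A) by exact: is_derive_rot.
have eP t : e t *m P = e t by exact: rot_in_plane.
pose w := e s; pose z := k + r *: w.
have dz : is_derive s 1 (fun t => k + r *: e t) (r *: (w *m A)).
  rewrite -[X in is_derive _ _ _ X]add0r.
  apply: is_deriveD; exact: is_deriveZ.
have dA : is_derive s 1 (fun t => e t *m A) (- w).
  have yAP : y *m A *m P = y *m A by rewrite -mulmxA plane_gen_proj.
  have comm t : y *m A *m Q t = e t *m A.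
    by rewrite rot_planeE// /e rot_planeE// 2!mulmxDl -!scalemxAl.
  have := is_derive_rot s yAP; rewrite comm -mulmxA plane_genK// mulmxN eP.
  by congr is_derive; apply/funext => t; rewrite comm.
have wAP : w *m A *m P = w *m A by rewrite -mulmxA plane_gen_proj.
have rwAP : r *: (w *m A) *m P = r *: (w *m A) by rewrite -scalemxAl wAP.
rewrite /flux -/(e s) -/w -/z (angle_identity (X z) r (eP s) (divX z)).
rewrite -(diff_in_plane z rwAP).
apply: is_deriveN; apply: is_derive_dot => //.
exact: is_derive_comp_diff.
Qed.

Lemma flux_continuous :
  continuous (fun q : (V * V * R) * R => flux q.1.1.1 q.1.1.2 q.1.2 q.2).
Proof.
pose e (q : (V * V * R) * R) := q.1.1.2 *m Q q.2.
pose z (q : (V * V * R) * R) := q.1.1.1 + q.1.2 *: e q.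
have c1 (S T : topologicalType) : continuous (@fst S T) by move=> ?; exact: cvg_fst.
have c2 (S T : topologicalType) : continuous (@snd S T) by move=> ?; exact: cvg_snd.
have comp (S T U : topologicalType) (f : S -> T) (g : T -> U) :
    continuous f -> continuous g -> continuous (fun x => g (f x)).
  by move=> cf cg x; apply: (@continuous_comp _ _ _ f g); [exact: cf|exact: cg].
have c12 : continuous (fun q : (V * V * R) * R => q.1.2).
  exact: comp (c1 _ _) (c2 _ _).
have c11 : continuous (fun q : (V * V * R) * R => q.1.1).
  exact: comp (c1 _ _) (c1 _ _).
have c111 : continuous (fun q : (V * V * R) * R => q.1.1.1).
  exact: comp c11 (c1 _ _).
have c112 : continuous (fun q : (V * V * R) * R => q.1.1.2).
  exact: comp c11 (c2 _ _).
have cmx (M : 'M[R]_d) : continuous (fun q : (V * V * R) * R => q.1.1.2 *m M).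
  exact: comp c112 (@mulmx_continuous _ _ M).
have ce : continuous e.
  have -> : e = (fun q => q.1.1.2 + (cos q.2 - 1) *: (q.1.1.2 *m P)
      + sin q.2 *: (q.1.1.2 *m A)).
    by apply/funext => q; rewrite /e /plane_rot 2!mulmxDr mulmx1 -!scalemxAr.
  move=> q; apply: cvgD.
    apply: cvgD; first exact: c112.
    apply: cvgZ; last exact: cmx.
    by apply: cvgB; [exact: comp (c2 _ _) (@continuous_cos _) q|exact: cvg_cst].
  by apply: cvgZ; [exact: comp (c2 _ _) (@continuous_sin _) q|exact: cmx].
have cz : continuous z.
  by move=> q; apply: cvgD; [exact: c111|apply: cvgZ; [exact: c12|exact: ce]].
have cdot (Y : V -> V) : continuous Y -> continuous (fun q => dot (Y (z q)) (e q)).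
  by move=> cY q; apply: dot_continuous; [exact: comp cz cY q|exact: ce].
have cX : continuous X by move=> x; exact: differentiable_continuous.
have cei i : continuous (fun q => e q 0 i).
  by apply: (comp _ _ _ e (fun v : V => v 0 i) ce); exact: coord_continuous.
move=> q; apply: (@cvgD _ _ _ _ _ (fun q => dot (X (z q)) (e q))); first exact: cdot.
apply: cvgM; first exact: c12.
apply: cvgD; apply: cvgM.
- exact: (cei a q).
- exact: (cdot _ cDa q).
- exact: (cei b q).
- exact: (cdot _ cDb q).
Qed.

(** The flux of [X] through a circle vanishes, as does its average over the
    circle. Equidistant points replace the integral: by the mean value theorem
    the periodicity of the angular primitive of [flux] makes its Riemann sums
    small, uniformly in the centre and the radius, and the sum of [r <X, e>]
    grows with [r] at the rate given by such a Riemann sum. *)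
Lemma circle_average (e M : R) : 0 < e -> exists N : nat, (0 < N)%N /\
  forall (k y : V) (r : R), `|k| <= M -> unit_sphere y -> y *m P = y -> `|r| <= M ->
  `|\sum_(l < N) dot (X (k + r *: (y *m Q (l%:R * (2 * pi / N%:R)))))
                     (y *m Q (l%:R * (2 * pi / N%:R)))| <= N%:R * e.
Proof.
move=> e0.
pose C := ([set k : V | `|k| <= M] `*` (@unit_sphere R d)) `*`
  [set r : R | `|r| <= M].
have cC : compact C.
  apply: compact_setX.
    apply: compact_setX; last exact: sphere_compact.
    apply: bounded_closed_compact.
      exists M; split => [|x Mx k kM]; first exact: num_real.
      exact: le_trans kM (ltW Mx).
    apply: (@preimage_closed _ _ (fun k : V => `|k|) [set x | x <= M]).
      by move=> k _; exact: norm_continuous.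
    exact: closed_le.
  rewrite (_ : mkset _ = `[- M, M]%classic); first exact: segment_compact.
  by apply/seteqP; split => x /=; rewrite in_itv/= ler_norml.
have /(_ _ e0) unif := @uniform_near0 R _ C
  (fun h p => flux p.1.1 p.1.2 p.2 h) cC (fun p _ => @flux_continuous (p, 0)).
have [N [N0 unifN]] : exists N : nat, (0 < N)%N /\
    forall h, 0 <= h <= 2 * pi / N%:R -> forall p, C p ->
    `|flux p.1.1 p.1.2 p.2 h - flux p.1.1 p.1.2 p.2 0| <= e.
  have [rho /= rho0 Hrho] := (nbhs_normP _ _).1 unif.
  exists (Num.truncn (2 * pi / rho)).+1; split => // h /andP[h0 hN] p Cp.
  apply: Hrho => //=; rewrite sub0r normrN ger0_norm// (le_lt_trans hN)//.
  rewrite ltr_pdivrMr ?ltr0n// [ltRHS]mulrC -ltr_pdivrMr//.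
  exact: truncnS_gt.
exists N; split=> // k y r kM y1 yP rM.
have N0' : (0 : R) < N%:R by rewrite ltr0n.
set dl := 2 * pi / N%:R.
have dl0 : 0 < dl by rewrite divr_gt0// mulr_gt0// pi_gt0.
(* [flux k y r'] is the derivative of the periodic function [g] below. *)
have riemann r' : `|r'| <= M -> `|\sum_(l < N) flux k y r' (l%:R * dl)| <= N%:R * e.
  move=> r'M.
  pose g s := - dot (X (k + r' *: (y *m Q s))) (y *m Q s *m A).
  have step (l : 'I_N) : exists x,
      g (l.+1%:R * dl) - g (l%:R * dl) = flux k y r' x * dl /\
      `|flux k y r' x - flux k y r' (l%:R * dl)| <= e.
    have [| s _|x /andP[x1 x2] gx] :=
      @mean_value _ g (flux k y r') (l%:R * dl) (l.+1%:R * dl).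
    - by rewrite ltr_pM2r// ltr_nat.
    - exact: is_derive_angle.
    exists x; split; first by rewrite gx -mulrBl -natrB// subSnn mul1r.
    have shift s : flux k y r' (l%:R * dl + s) = flux k (y *m Q (l%:R * dl)) r' s.
      by rewrite /flux -plane_rotD// mulmxA.
    rewrite -{1}(subrKC (l%:R * dl) x) -[X in _ - flux k y r' X]addr0 !shift.
    apply: (unifN _ _ (k, y *m Q (l%:R * dl), r')); last first.
      split => //; split => //=.
      by rewrite /unit_sphere /= dot_orthogonal// plane_rot_orthogonal.
    move: x1 x2; rewrite -natr1 mulrDl mul1r -/dl => x1 x2.
    by apply/andP; split; lra.
  have [x xP] := choice step.
  have gper : g (N%:R * dl) = g 0.
    have -> : N%:R * dl = pi + pi by rewrite /dl mulrC divfK ?gt_eqF//; ring.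
    by rewrite /g /plane_rot cosDpi sinDpi cospi sinpi cos0 sin0 opprK oppr0.
  have fluxx0 : \sum_(l < N) flux k y r' (x l) = 0.
    apply: (mulIf (lt0r_neq0 dl0)); rewrite mul0r mulr_suml.
    under eq_bigr => l _ do rewrite -(xP l).1.
    rewrite -(big_mkord xpredT (fun l => g (l.+1%:R * dl) - g (l%:R * dl))).
    by rewrite (telescope_sumr (fun l => g (l%:R * dl)))// gper mul0r subrr.
  have -> : \sum_(l < N) flux k y r' (l%:R * dl) =
      \sum_(l < N) (flux k y r' (l%:R * dl) - flux k y r' (x l)).
    by rewrite sumrB fluxx0 subr0.
  rewrite (le_trans (ler_norm_sum _ _ _))//.
  rewrite (@le_trans _ _ (\sum_(l < N) e))//.
    by apply: ler_sum => l _; rewrite distrC; exact: (xP l).2.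
  by rewrite sumr_const card_ord -[leLHS]mulr_natl.
(* Dividing by the radius is impossible at the centre, where the average of
   [<X, e>] is already a Riemann sum of [flux]. *)
have [->|r0] := eqVneq r 0.
  have := riemann 0; rewrite normr0 (le_trans _ kM)// => /(_ isT).
  congr (`|_| <= _); apply: eq_bigr => l _.
  by rewrite /flux mul0r addr0.
rewrite -(ler_pM2r (_ : 0 < `|r|)) ?normr_gt0// -normrM mulr_suml.
have := @mean_value_bound _
  (fun t => \sum_(l < N)
     t * dot (X (k + t *: (y *m Q (l%:R * dl)))) (y *m Q (l%:R * dl)))
  (fun t => \sum_(l < N) flux k y t (l%:R * dl)) r (N%:R * e).
rewrite [X in _ - X]big1 => [|l _]; last by rewrite mul0r.
rewrite subr0; under eq_bigr do rewrite mulrC.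
apply => t tr; last by apply: riemann; exact: le_trans tr rM.
pose h (l : 'I_N) t :=
  t * dot (X (k + t *: (y *m Q (l%:R * dl)))) (y *m Q (l%:R * dl)).
have -> : (fun t => \sum_(l < N) h l t) = \sum_(l < N) h l.
  by apply/funext => x; rewrite fct_sumE.
apply: is_derive_sum => l; exact: is_derive_radius.
Qed.

End CircleFlux.

Section ToricOrbit.
Context {R : realType} {d : nat}.
Local Notation V := 'rV[R]_d.
Variables (a b : 'I_d).
Hypothesis ab : a != b.
Local Notation P := (plane_proj a b : 'M[R]_d).
Local Notation A := (plane_gen a b : 'M[R]_d).
Local Notation Q := (plane_rot a b).
Variables (K : set V) (M : R).
Hypothesis KQ : forall s z, K z -> K (z *m Q s).
Hypothesis KM : forall z, K z -> `|z| <= M.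

(** The form [<., u>] is maximal at [k] on the circle through [k] traced by the
    rotations of the plane, so that its derivative along this circle vanishes
    at [k]. *)
Lemma maximizer_parallel k u : K k -> (forall z, K z -> dot z u <= dot k u) ->
  k 0 a * u 0 b = k 0 b * u 0 a.
Proof.
move=> Kk kmax; pose al := dot u (k *m P); pose ga := dot u (k *m A).
have le0 s : (cos s - 1) * al + sin s * ga <= 0.
  have := kmax _ (KQ s Kk); rewrite (dotC _ u) (dotC k u) dot_plane_rot -/al -/ga.
  lra.
have bound m : `|ga| <= al * ((1 - cos (m.+1%:R^-1 : R)) / sin (m.+1%:R^-1 : R)).
  have s0 := @sin_invS_gt0 R m.
  rewrite mulrA ler_pdivlMr// -[X in _ * X](gtr0_norm s0) -normrM ler_norml.
  have := le0 (m.+1%:R^-1); have := le0 (- m.+1%:R^-1); rewrite cosN sinN.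
  by move=> h1 h2; apply/andP; split; lra.
have lim0 : (fun m => al * ((1 - cos (m.+1%:R^-1 : R)) / sin (m.+1%:R^-1 : R)))
    @ \oo --> 0.
  rewrite -[X in _ --> X](mulr0 al).
  by apply: cvgM; [exact: cvg_cst|exact: half_tan_cvg0].
have : `|ga| <= 0.
  by rewrite -(cvg_lim _ lim0)//; apply: limr_ge; [exact: cvgP lim0|exact: nearW].
by rewrite normr_le0 /ga dot_plane_gen subr_eq0 => /eqP.
Qed.

Variable X : V -> V.
Hypothesis dX : forall z, differentiable X z.
Hypothesis cDa : continuous ('D_(delta_mx 0 a : V) X).
Hypothesis cDb : continuous ('D_(delta_mx 0 b : V) X).
Hypothesis divX : forall z,
  'D_(delta_mx 0 a : V) X z 0 a + 'D_(delta_mx 0 b : V) X z 0 b = 0.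

(** If [u] has a nonzero component in the plane, then by [maximizer_parallel] the
    components of [k] and [u] there are multiples of one unit vector [y], so that
    the sum is the flux of [X] through a circle, up to the factor [|u P|], which
    is at most 1. It is essential that [N] depends neither on [k] nor on [u]. *)
Lemma orbit_average (e : R) : 0 < e -> exists N : nat, (0 < N)%N /\
  exists s : nat -> R, forall k u, K k -> (forall z, K z -> dot z u <= dot k u) ->
  unit_sphere u ->
  `|N%:R^-1 * \sum_(l < N) dot (X (k *m Q (s l)) *m P) (u *m Q (s l))| <= e.
Proof.
move=> e0.
(* The bound dominates both [|k - k P|] and [|<k, y>|]. *)
have [N [N0 avgN]] := circle_average ab dX cDa cDb divX
  (M + d%:R * `|P| * M + d%:R * M) e0.
exists N; split => //; exists (fun l => l%:R * (2 * pi / N%:R)) => k u Kk kmax u1.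
rewrite normrM gtr0_norm ?invr_gt0 ?ltr0n// ler_pdivrMl ?ltr0n//.
have PQ t : P *m Q t = Q t *m P.
  rewrite /plane_rot 2!mulmxDr 2!mulmxDl mulmx1 mul1mx -!scalemxAr -!scalemxAl.
  by rewrite plane_proj_gen// plane_gen_proj.
under eq_bigr => l _ do
  rewrite dot_mulmxl trmx_plane_proj -[u *m _ *m _]mulmxA -PQ mulmxA.
pose c2 := u 0 a ^+ 2 + u 0 b ^+ 2.
have c2ge0 : 0 <= c2 by rewrite addr_ge0 ?sqr_ge0.
have M0 : 0 <= M by exact: le_trans (KM Kk).
(* If [u] has no component in the plane, the direction [y] is undefined. *)
have [c20|c2n0] := eqVneq c2 0.
  have -> : u *m P = 0.
    move/eqP: c20; rewrite paddr_eq0 ?sqr_ge0// !sqrf_eq0 => /andP[/eqP ua /eqP ub].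
    by rewrite mul_plane_proj ua ub !scale0r addr0.
  rewrite big1 => [|l _]; first by rewrite normr0 mulr_ge0 ?ler0n// (ltW e0).
  by rewrite mul0mx dotC dot0l.
pose c := Num.sqrt c2.
have c0 : 0 < c by rewrite sqrtr_gt0 lt_neqAle eq_sym c2n0.
have cc : c * c = c2 by rewrite -expr2 sqr_sqrtr.
have c1 : c <= 1.
  rewrite -(@ler_pXn2r _ 2)// ?nnegrE ?(ltW c0)// expr1n expr2 cc -u1 /dot.
  rewrite (bigD1 a)//= (bigD1 b)//= 1?eq_sym// addrA -!expr2 lerDl.
  by apply: sumr_ge0 => i _; rewrite -expr2 sqr_ge0.
pose y := c^-1 *: (u *m P).
have cy : u *m P = c *: y by rewrite scalerA divff ?scale1r// gt_eqF.
have yP : y *m P = y by rewrite -scalemxAl -mulmxA plane_projK.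
have y1 : unit_sphere y.
  rewrite /unit_sphere /= dotZl dotZr dot_mulmxl trmx_plane_proj -mulmxA.
  rewrite plane_projK//.
  rewrite dot_plane_proj -!expr2 -/c2 -cc mulrA -invfM.
  by rewrite mulVf// mulf_neq0 ?gt_eqF.
pose r := dot k y.
have kP : k *m P = r *: y.
  have par := maximizer_parallel Kk kmax.
  pose D := u 0 a * k 0 a + u 0 b * k 0 b.
  have Da : D * u 0 a = c2 * k 0 a.
    have -> : D * u 0 a = u 0 a ^+ 2 * k 0 a + u 0 b * (k 0 b * u 0 a).
      by rewrite /D; ring.
    by rewrite -par /c2; ring.
  have Db : D * u 0 b = c2 * k 0 b.
    have -> : D * u 0 b = u 0 a * (k 0 a * u 0 b) + u 0 b ^+ 2 * k 0 b.
      by rewrite /D; ring.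
    by rewrite par /c2; ring.
  have -> : r *: y = (D / c2) *: (u *m P).
    by rewrite /r /y dotZr dot_plane_proj scalerA mulrAC -invfM cc mulrC.
  rewrite !mul_plane_proj scalerDr !scalerA.
  by rewrite mulrAC Da [D / c2 * _]mulrAC Db ![c2 * _ / c2]mulrAC divff// !mul1r.
pose k0 := k - k *m P.
have k0P : k0 *m P = 0 by rewrite mulmxBl -mulmxA plane_projK// subrr.
have k0Q t : k0 *m Q t = k0.
  rewrite /plane_rot 2!mulmxDr mulmx1 -!scalemxAr k0P.
  by rewrite -(plane_proj_gen ab) mulmxA k0P mul0mx !scaler0 !addr0.
have kQ t : k *m Q t = k0 + r *: (y *m Q t).
  by rewrite -[k in LHS](subrK (k *m P)) mulmxDl k0Q kP -scalemxAl.
have kM := KM Kk.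
have PM : `|k *m P| <= d%:R * `|P| * M.
  by rewrite (le_trans (ler_norm_mulmx _ _))// ler_wpM2l.
have rM : `|r| <= d%:R * M.
  by rewrite (le_trans (norm_sphere_dot _ y1))// ler_wpM2l.
have dP0 : 0 <= d%:R * `|P| * M by rewrite !mulr_ge0.
have dM0 : 0 <= d%:R * M by rewrite mulr_ge0.
have k0M : `|k0| <= M + d%:R * `|P| * M + d%:R * M.
  by rewrite (le_trans (ler_normB _ _))// (le_trans (lerD kM PM))// lerDl.
have rM' : `|r| <= M + d%:R * `|P| * M + d%:R * M.
  by rewrite (le_trans rM)// lerDr addr_ge0.
have H := avgN k0 y r k0M y1 yP rM'.
rewrite (eq_bigr (fun l : 'I_N => c *
    dot (X (k0 + r *: (y *m Q (l%:R * (2 * pi / N%:R)))))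
      (y *m Q (l%:R * (2 * pi / N%:R))))) => [|l _]; last first.
  by rewrite kQ cy -[(c *: y) *m _]scalemxAl dotZr.
by rewrite -mulr_sumr normrM gtr0_norm// (le_trans _ H)// ler_piMl.
Qed.

End ToricOrbit.

(** * The derivative of the mean width *)

Section ToricRotations.
Context {R : realType} {n : nat}.
Local Notation V := 'rV[R]_(n + n).

Lemma torus_act_plane_rot (j : 'I_n) s (z : V) :
  torus_act (fun i => if i == j then s else 0) z =
  z *m plane_rot (lshift n j) (rshift n j) s.
Proof.
apply/rowP => i; rewrite -[RHS]dot_delta dot_plane_rot dot_plane_proj dot_plane_gen.
rewrite dot_delta -[i]splitK; case: (fintype.split i) => l /=.
- rewrite row_mxEl !mxE !eqxx /= eq_lshift eq_rlshift (eq_sym j).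
  case: eqVneq => [->|_] /=; first ring.
  by rewrite cos0 sin0; ring.
- rewrite row_mxEr !mxE !eqxx /= eq_rshift eq_lrshift (eq_sym j).
  case: eqVneq => [->|_] /=; first ring.
  by rewrite cos0 sin0; ring.
Qed.

Lemma toric_plane_rot (K : set V) (j : 'I_n) s : toric K ->
  [set z *m plane_rot (lshift n j) (rshift n j) s | z in K] = K.
Proof.
move=> /(_ (fun i => if i == j then s else 0)) {2}<-.
by apply/seteqP; split => _ [z Kz <-]; exists z => //; rewrite torus_act_plane_rot.
Qed.

Lemma dot_sum_planes (v u : V) :
  \sum_(j < n) dot v (u *m plane_proj (lshift n j) (rshift n j)) = dot v u.
Proof.
under eq_bigr do rewrite dot_plane_proj.
rewrite big_split /= /dot big_split_ord /=.
by congr (_ + _); apply: eq_bigr => j _; rewrite mulrC.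
Qed.

Lemma rotation_opp : rotation (- 1%:M : 'M[R]_(n + n)).
Proof.
split; first by rewrite linearN /= trmx1 mulNmx mulmxN mul1mx opprK.
by rewrite -scaleN1r detZ det1 mulr1 -signr_odd addnn odd_double.
Qed.

End ToricRotations.

Section DifferenceQuotient.
Context {R : realType} {d : nat}.
Local Notation V := 'rV[R]_d.
Local Notation S := (@unit_sphere R d).
Variables (K : set V) (M : R).
Hypotheses (K0 : K !=set0) (KM : forall z, K z -> `|z| <= M).

Definition support_quotient (f : V -> V) (t : R) (u : V) : R :=
  t^-1 * (support_function (f @` K) u - support_function K u).

Lemma support_image_continuous f c : (forall k, K k -> `|f k - k| <= c) ->
  continuous (support_function (f @` K)).
Proof.
move=> fc; apply: (@support_continuous _ _ _ (M + c)).
  by case: K0 => k Kk; exists (f k), k.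
move=> _ [k Kk <-]; rewrite -(subrK k (f k)) addrC (le_trans (ler_normD _ _))//.
by rewrite lerD ?KM ?fc.
Qed.

Lemma support_quotient_continuous f t c : (forall k, K k -> `|f k - k| <= c) ->
  continuous (support_quotient f t).
Proof.
move=> fc; apply: continuous_mull.
have cK : continuous (support_function K) by exact: support_continuous KM.
have cf := support_image_continuous fc.
exact: continuous_sub.
Qed.

Lemma support_quotient_bound f t c u : t != 0 -> S u ->
  (forall k, K k -> `|f k - k| <= c * `|t|) ->
  `|support_quotient f t u| <= d%:R * c.
Proof.
move=> t0 Su fc; rewrite normrM normfV mulrC ler_pdivrMr ?normr_gt0//.
have := support_perturb u K0 KM fc; move=> /le_trans; apply.
rewrite -!mulrA ler_wpM2l//.
have [k Kk] := K0; have ct0 : 0 <= c * `|t| by exact: le_trans (fc k Kk).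
by rewrite mulrA -[leRHS]mulr1 ler_wpM2l// sphere_norm.
Qed.

Lemma support_quotient_cvg psi (X : V -> V) u k (t : nat -> R) : compact K ->
  continuous X -> first_order K psi X -> exposed K u k ->
  (forall m, t m != 0) -> t @ \oo --> 0 ->
  (fun m => support_quotient (psi (t m)) (t m) u) @ \oo --> dot (X k) u.
Proof.
move=> cK cX psiX ku t0 tcvg; apply/cvgrPdist_le => e e0.
have H := support_derivative cK KM cX psiX ku e0.
have : \forall m \near \oo,
    `|support_function (psi (t m) @` K) u - support_function K u
      - t m * dot (X k) u| <= e * `|t m| by exact: tcvg H.
apply: filterS => m Hm; rewrite distrC.
have -> : support_quotient (psi (t m)) (t m) u - dot (X k) u =
  (t m)^-1 * (support_function (psi (t m) @` K) u - support_function K u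
      - t m * dot (X k) u).
  by rewrite /support_quotient [RHS]mulrBr mulKf.
by rewrite normrM normfV mulrC ler_pdivrMr ?normr_gt0.
Qed.

End DifferenceQuotient.

Lemma ler_norm_sum_ord (R : numDomainType) (m : nat) (g : 'I_m -> R) c :
  (forall i, `|g i| <= c) -> `|\sum_i g i| <= m%:R * c.
Proof.
move=> gc; rewrite (le_trans (ler_norm_sum _ _ _))//.
rewrite (@le_trans _ _ (\sum_(i < m) c))//; first exact: ler_sum.
by rewrite sumr_const card_ord -[leLHS]mulr_natl.
Qed.

Lemma continuous_on_compact_bounded (R : realType) (V W : normedModType R)
    (K : set V) (X : V -> W) : compact K -> continuous X ->
  exists B, forall k, K k -> `|X k| <= B.
Proof.
move=> cK cX.
have : compact (X @` K).
  by apply: continuous_compact cK; exact: continuous_subspaceT.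
move=> /compact_bounded[B [Br bB]]; exists (B + 1) => k Kk.
by apply: bB; [rewrite ltrDl|exists k].
Qed.

Section MeanWidthDerivative.
Context {R : realType} {n : nat}.
Local Notation V := 'rV[R]_(n + n).
Local Notation S := (@unit_sphere R (n + n)).
Local Notation P j := (plane_proj (lshift n j) (rshift n j) : 'M[R]_(n + n)).
Local Notation Q j := (plane_rot (lshift n j) (rshift n j)).
Variable sigma : probability (@borel_rV R (n + n)) R.
Hypothesis hsigma : rotation_invariant_on_sphere sigma.
Variables (K : set V) (M : R).
Hypotheses (cK : compact K) (K0 : K !=set0) (KM : forall z, K z -> `|z| <= M).
Hypothesis tK : toric K.

(** The dimension is even, so that the antipodal map is a rotation. *)
Lemma mean_width_support f c : (forall k, K k -> `|f k - k| <= c) ->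
  mean_width sigma (f @` K) = 2 * \int[sigma]_(u in S) support_function (f @` K) u.
Proof.
move=> fc; have cf := support_image_continuous K0 KM fc.
have mS := @sphere_measurable R (n + n).
have oppE u : - u = u *m - 1%:M :> V by rewrite mulmxN mulmx1.
have -> : mean_width sigma (f @` K) = \int[sigma]_(u in S)
    (support_function (f @` K) u + support_function (f @` K) (u *m - 1%:M)).
  by apply: eq_Rintegral => u _; rewrite -oppE.
rewrite RintegralD//; last 2 first.
- exact: continuous_integrable.
- apply: (continuous_integrable _
    (g := fun u => support_function (f @` K) (u *m - 1%:M))) => u.
  apply: (@continuous_comp _ _ _ (fun u : V => u *m - 1%:M)); last exact: cf.
  exact: mulmx_continuous.
rewrite (Rintegral_rotation hsigma rotation_opp cf); ring.
Qed.

Variables (phi : R -> V -> V) (X : V -> V).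
Hypothesis phiX : first_order K phi X.
Hypothesis dX : forall z, differentiable X z.
Hypothesis cDX : forall v, continuous ('D_v X).
Hypothesis divX : forall z j,
  'D_(delta_mx 0 (lshift n j)) X z 0 (lshift n j) +
  'D_(delta_mx 0 (rshift n j)) X z 0 (rshift n j) = 0.

(** Let [Y m] be the difference quotient of the support function for the path and
    [Z j m] the one for the deformation along the component of [X] in the [j]-th
    symplectic plane. By invariance [Y m] has the same integral as
      [f m = Y m - sum_j Z j m + sum_j (average of Z j m over N j rotations)].
    At almost every [u], with maximizer [k], the limits of [Y m] and [sum_j Z j m]
    cancel because [X] is the sum of its components; the limit of the last sum
    is small by [orbit_average]. *)
Lemma Rintegral_support_quotient_small (C : R) (t : nat -> R) :
    (forall m, t m != 0) -> t @ \oo --> 0 ->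
    (forall m k, K k -> `|phi (t m) k - k| <= C * `|t m|) ->
  forall e : R, 0 < e -> \forall m \near \oo,
    `|\int[sigma]_(u in S) support_quotient K (phi (t m)) (t m) u| <= e.
Proof.
move=> t0 tcvg phiC e e0.
have cX : continuous X by move=> x; exact: differentiable_continuous.
pose psi (j : 'I_n) t z : V := z + t *: (X z *m P j).
have cXP j : continuous (fun z => X z *m P j).
  move=> z; apply: (@continuous_comp _ _ _ X (fun u : V => u *m P j)).
    exact: cX.
  exact: mulmx_continuous.
have psiX j : first_order K (psi j) (fun z => X z *m P j).
  move=> r r0; exists 1 => //= s _ k Kk.
  by rewrite /psi [k + _ - k]addrAC subrr add0r subrr normr0 mulr_ge0// ltW.
have [B0 XB0] := continuous_on_compact_bounded cK cX.
have B00 : 0 <= B0 by have [k Kk] := K0; exact: le_trans (XB0 k Kk).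
pose B := \sum_(j < n) (n + n)%:R * `|P j| * B0.
have XB j k : K k -> `|X k *m P j| <= B.
  move=> Kk; rewrite (le_trans (ler_norm_mulmx _ _))//.
  rewrite (@le_trans _ _ ((n + n)%:R * `|P j| * B0))//.
    by rewrite ler_wpM2l ?mulr_ge0// XB0.
  by rewrite /B (bigD1 j)//= lerDl sumr_ge0// => i _; rewrite !mulr_ge0.
have psiB j s k : K k -> `|psi j s k - k| <= B * `|s|.
  by move=> Kk; rewrite /psi addrAC subrr add0r normrZ mulrC ler_wpM2r// XB.
pose eps := e / (n.+1%:R).
have eps0 : 0 < eps by rewrite divr_gt0.
have KQ j s z : K z -> K (z *m Q j s).
  by move=> Kz; rewrite -(toric_plane_rot j s tK); exists z.
have xy j : lshift n j != rshift n j by rewrite eq_lrshift.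
have /choice[N /all_and2[N0 /choice[s avg]]] :
  forall j : 'I_n, exists N : nat, (0 < N)%N /\
  exists s : nat -> R, forall k u, K k -> (forall z, K z -> dot z u <= dot k u) ->
  S u -> `|N%:R^-1 * \sum_(l < N)
             dot (X (k *m Q j (s l)) *m P j) (u *m Q j (s l))| <= eps.
  move=> j; apply: (orbit_average (xy j) (KQ j) KM dX) => //.
pose Y m := support_quotient K (phi (t m)) (t m).
pose Z j m := support_quotient K (psi j (t m)) (t m).
pose f m u := Y m u - \sum_j Z j m u +
  \sum_j (N j)%:R^-1 * \sum_(l < N j) Z j m (u *m Q j (s j l)).
have cY m : continuous (Y m) := support_quotient_continuous K0 KM (phiC m).
have cZ j m : continuous (Z j m).
  by apply: (support_quotient_continuous K0 KM) => k; exact: psiB.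
have cZQ j m x : continuous (fun u : V => Z j m (u *m Q j x)).
  move=> u; apply: (@continuous_comp _ _ _ (fun u : V => u *m Q j x)).
    exact: mulmx_continuous.
  exact: cZ.
have csum (T : topologicalType) (I : Type) (r : seq I) (g : I -> T -> R) :
    (forall i, continuous (g i)) -> continuous (fun u : T => \sum_(i <- r) g i u).
  by move=> cg; apply: continuous_big => //; exact: add_continuous.
have cavg j m : continuous (fun u : V =>
    (N j)%:R^-1 * \sum_(l < N j) Z j m (u *m Q j (s j l))).
  apply: continuous_mull; apply: csum => l; exact: cZQ.
have cf1 m : continuous (fun u : V => Y m u - \sum_j Z j m u).
  by apply: continuous_sub => //; exact: csum.
have mS := @sphere_measurable R (n + n).
have cf m : continuous (f m).
  by apply: continuous_add; [exact: cf1|exact: csum].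
have If m : \int[sigma]_(u in S) Y m u = \int[sigma]_(u in S) f m u.
  rewrite RintegralD//; last 2 first.
  - exact: (continuous_integrable _ (cf1 m)).
  - by apply: (continuous_integrable _ (g := fun u => \sum_j _)); exact: csum.
  rewrite RintegralB//; last 2 first.
  - exact: (continuous_integrable _ (cY m)).
  - by apply: (continuous_integrable _ (g := fun u => \sum_j _)); exact: csum.
  rewrite Rintegral_sphere_sum// Rintegral_sphere_sum// -addrA; apply/esym.
  rewrite -[RHS]addr0; congr (_ + _); rewrite addrC -sumrB big1// => j _.
  rewrite RintegralZl//; last first.
    by apply: (continuous_integrable _ (g := fun u => \sum_(l < N j) _));
      exact: csum.
  rewrite Rintegral_sphere_sum//.
  under eq_bigr => l _ do
    rewrite (Rintegral_rotation hsigma (plane_rotP (xy j) _) (cZ j m)).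
  rewrite sumr_const card_ord -[X in _ * X]mulr_natl mulKf ?subrr//.
  by rewrite pnatr_eq0 -lt0n.
have H := @Rintegral_small _ _ sigma hsigma f
  ((n + n)%:R * C + n%:R * ((n + n)%:R * B) + n%:R * ((n + n)%:R * B)) (n%:R * eps).
suff : \forall m \near \oo, `|\int[sigma]_(u in S) f m u| <= e.
  by apply: filterS => m; rewrite -If.
apply: H.
- by rewrite mulr_ge0// ltW.
- exact: cf.
- move=> m u Su.
  have bZ j v : S v -> `|Z j m v| <= (n + n)%:R * B.
    move=> Sv; apply: (support_quotient_bound K0 KM (t0 m) Sv) => k.
    exact: psiB.
  have SQ j x : S (u *m Q j x).
    by rewrite /unit_sphere /= dot_orthogonal// plane_rot_orthogonal.
  rewrite (le_trans (ler_normD _ _))// lerD//.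
    rewrite (le_trans (ler_normB _ _))// lerD//.
      exact: (support_quotient_bound K0 KM (t0 m) Su (phiC m)).
    by apply: ler_norm_sum_ord => j; exact: bZ.
  apply: ler_norm_sum_ord => j; rewrite normrM normfV normr_nat.
  rewrite ler_pdivrMl ?ltr0n//; apply: ler_norm_sum_ord => l; exact: bZ.
- have := ae_exposed hsigma cK K0 KM => H.
  apply: (negligibleS _ H) => u; apply: contra_not => {}H Su.
  have {H} [k ku] := H Su.
  pose lim := \sum_j (N j)%:R^-1 * \sum_(l < N j)
    dot (X (k *m Q j (s j l)) *m P j) (u *m Q j (s j l)).
  have flim : (fun m => f m u) @ \oo --> lim.
    have -> : lim = dot (X k) u - \sum_j dot (X k *m P j) u + lim.
      under eq_bigr do rewrite dot_mulmxl trmx_plane_proj.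
      by rewrite dot_sum_planes subrr add0r.
    apply: cvgD; first apply: cvgB.
    - exact: (support_quotient_cvg KM cK cX phiX ku t0 tcvg).
    - apply: cvg_big => [|j _]; first exact: add_continuous.
      exact: (support_quotient_cvg KM cK (cXP j) (psiX j) ku t0 tcvg).
    apply: cvg_big => [|j _]; first exact: add_continuous.
    apply: cvgM; first exact: cvg_cst.
    apply: cvg_big => [|l _]; first exact: add_continuous.
    apply: (support_quotient_cvg KM cK (cXP j) (psiX j) _ t0 tcvg).
    apply: exposed_mulmx => //; first exact: plane_rot_orthogonal.
    exact: toric_plane_rot.
  have lime : `|lim| <= n%:R * eps.
    apply: ler_norm_sum_ord => j; apply: avg => //; first exact: ku.1.
    by move=> z; exact: exposed_le.
  move=> e' ee'; have lime' := le_lt_trans lime ee'.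
  have nlim : (fun m => `|f m u|) @ \oo --> `|lim| by exact: cvg_norm.
  by apply: (cvgr_le _ nlim).
- by rewrite /eps mulrCA gtr_pMr// ltr_pdivrMr// mul1r ltr_nat.
Qed.

(** The limit is tested on sequences of times, because dominated convergence is a
    statement about sequences. *)
Lemma is_derive_mean_width : (forall z, phi 0 z = z) ->
  is_derive (0 : R) 1 (fun t => mean_width sigma (phi t @` K)) 0.
Proof.
move=> phi0.
have cX : continuous X by move=> x; exact: differentiable_continuous.
have [B XB] := continuous_on_compact_bounded cK cX.
have near_bound := first_order_bound phiX XB.
pose F t := mean_width sigma (phi t @` K).
have FE t : t != 0 -> (forall k, K k -> `|phi t k - k| <= (B + 1) * `|t|) ->
    F t - F 0 = t * (2 * \int[sigma]_(u in S) support_quotient K (phi t) t u).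
  move=> t0 Ht.
  have mS := @sphere_measurable R (n + n).
  have phi0B k : K k -> `|phi 0 k - k| <= 0 by rewrite phi0 subrr normr0.
  have phi0K : phi 0 @` K = K.
    by apply/seteqP; split => [_ [z Kz <-]|z Kz]; [rewrite phi0|exists z].
  rewrite /F (mean_width_support Ht) (mean_width_support phi0B) phi0K.
  have ch : continuous (support_function K) by exact: support_continuous KM.
  have cht := support_image_continuous K0 KM Ht.
  rewrite RintegralZl//; last first.
    apply: (continuous_integrable _
      (g := fun u => support_function (phi t @` K) u - support_function K u)).
    exact: continuous_sub.
  rewrite RintegralB//; [|exact: continuous_integrable|exact: continuous_integrable].
  by rewrite mulrCA mulVKf// mulrBr.
have lim0 : (fun t => t^-1 *: (F t - F 0)) @ 0^' --> 0.
  apply/cvgrPdist_le => e e0; apply: contrapT => bad.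
  have bad_seq m : exists t, [/\ t != 0, `|t| < m.+1%:R^-1,
      (forall k, K k -> `|phi t k - k| <= (B + 1) * `|t|) &
      e < `|0 - t^-1 *: (F t - F 0)|].
    apply: contrapT => nbad; apply: bad.
    have m0 : 0 < m.+1%:R^-1 :> R by rewrite invr_gt0.
    near=> t; rewrite leNgt; apply/negP => et; apply: nbad; exists t; split => //.
    - by near: t; exact: nbhs_dnbhs_neq.
    - by near: t; exact: dnbhs0_lt.
    - by near: t; exact: nbhs_dnbhs near_bound.
  have [t tP] := choice bad_seq.
  have t0 m : t m != 0 by case: (tP m).
  have tB m k : K k -> `|phi (t m) k - k| <= (B + 1) * `|t m|.
    by case: (tP m) => _ _ + _; exact.
  have tcvg : t @ \oo --> 0.
    apply/cvgrPdist_le => r r0; apply: filterS (near_infty_natSinv_lt (PosNum r0)).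
    move=> m /= mr; rewrite sub0r normrN ltW// (lt_trans _ mr)//.
    by case: (tP m).
  have [m _ /(_ m (leqnn m)) /= Hm] :=
    Rintegral_support_quotient_small t0 tcvg tB (divr_gt0 e0 (ltr0Sn _ 1)).
  have [_ _ _] := tP m; rewrite FE//; last exact: tB.
  rewrite sub0r normrN [_ *: _]mulKf// normrM ger0_norm// ltNge.
  by move: Hm; rewrite ler_pdivlMr// mulrC => ->.
have E : (fun h => h^-1 *: ((F \o shift 0) (h *: 1) - F 0)) =
    (fun h => h^-1 *: (F h - F 0)).
  by apply/funext => h /=; rewrite addr0 [_ *: 1]mulr1.
split; first by apply/cvg_ex; exists 0; rewrite E.
by rewrite /derive E; exact: cvg_lim lim0.
Unshelve. all: by end_near. Qed.

End MeanWidthDerivative.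

Theorem theorem1p3 (R : realType) (n : nat)
    (sigma : probability (@borel_rV R (n + n)) R)
    (hsigma : rotation_invariant_on_sphere sigma)
    (K : set 'rV[R]_(n + n)) (hK : toric_convex_domain K)
    (I : set R) (hIopen : open I) (hIitv : is_interval I) (hI0 : I 0)
    (phi : R -> 'rV[R]_(n + n) -> 'rV[R]_(n + n))
    (hphi : smooth_symp_path I phi)
    (hphi0 : forall z, phi 0 z = z) :
  derivable (fun t : R => mean_width sigma (phi t @` K)) 0 1 /\
  derive1 (fun t : R => mean_width sigma (phi t @` K)) 0 = 0.
Proof.
have [[cK _ [x0 intx0]] tK] := hK.
have K0 : K !=set0 by exists x0; exact: interior_subset intx0.
have [M KM] := continuous_on_compact_bounded cK (fun z => @cvg_id _ (nbhs z)).
have [dM DM] : is_derive (0 : R) 1 (fun t => mean_width sigma (phi t @` K)) 0.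
  apply: (is_derive_mean_width hsigma cK K0 KM tK
    (velocity_first_order hIopen hI0 hphi.2 cK hphi0)) => //.
  - exact: differentiable_velocity hphi.2.
  - exact: derive_velocity_continuous hphi.2.
  - by move=> z j; exact: velocity_divergence_free hphi hphi0 z j.
by split; rewrite ?derive1E.
Qed.
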